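(* Let $\Bbbk$ be a field and let $I\subseteq S$ be a minimal monomial ideal, i.e. $I=M(L)\subseteq S=S(L)$ for some finite atomic lattice $L$. If the LCM lattice $\mathcal{L}_I$ is modular, then $S/I$ is Cohen–Macaulay.
   Context: The LCM lattice $\mathcal{L}_I$ of a monomial ideal $I$ is the set of least common multiples of subsets of its minimal monomial generators (the lcm of the empty set is $1$), ordered by divisibility; it is a finite lattice with join lcm. In a finite lattice $L$ with bottom $\hat 0$ and top $\hat 1$: an atom is an element covering $\hat 0$; $L$ is atomic if every element is a (possibly empty) join of atoms; an element $x\neq\hat 1$ is meet-irreducible if $x=a\wedge b$ implies $x=a$ or $x=b$. Write $\operatorname{at}(L)$ and $\operatorname{mi}(L)$ for the sets of atoms and meet-irreducible elements. For a finite atomic lattice $L$, the Phan ideal is $$M(L)=\Big(\prod_{a\in\operatorname{mi}(L),\ b\not\le a}x_a\ \Big|\ b\in\operatorname{at}(L)\Big)\subseteq S(L)=\Bbbk[x_a\mid a\in\operatorname{mi}(L)].$$ It satisfies $\mathcal{L}_{M(L)}\cong L$. A squarefree monomial ideal is called minimal if it equals $M(L)$ for some finite atomic lattice $L$. A finite lattice is graded if it has an order-preserving function $\operatorname{rk}:L\to\mathbb{Z}$ with $\operatorname{rk}(\hat 0)=0$ and $\operatorname{rk}(y)=\operatorname{rk}(x)+1$ whenever $y$ covers $x$; it is modular if it is graded and $\operatorname{rk}(x)+\operatorname{rk}(y)=\operatorname{rk}(x\wedge y)+\operatorname{rk}(x\vee y)$ for all $x,y\in L$. *)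

(* Defs.v *)
From HB Require Import structures.
From mathcomp Require Import all_boot all_order all_algebra.
From mathcomp Require Import ring.
From mathcomp Require Import boolp.
From mathcomp Require Import mpoly.

Set Implicit Arguments.
Unset Strict Implicit.
Unset Printing Implicit Defensive.

Import Order.TTheory GRing.Theory Num.Theory.
Local Open Scope ring_scope.
Local Open Scope quotient_scope.

Section Localization.
Variables (R : comNzRingType) (P : prime_idealr R).

Definition denom : Type := {s : R | s \notin P}.
HB.instance Definition _ := SubChoice.on denom.

Lemma denom1_subproof : 1 \notin P.
Proof. by rewrite idealr1. Qed.
Definition denom1 : denom := exist (fun s => s \notin P) 1 denom1_subproof.

Lemma denomM_subproof (s t : denom) : val s * val t \notin P.
Proof. by rewrite prime_idealrM negb_or (valP s) (valP t). Qed.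
Definition denomM (s t : denom) : denom :=
  exist (fun s => s \notin P) _ (denomM_subproof s t).

Definition fracs : Type := (R * denom)%type.
HB.instance Definition _ := Choice.on fracs.

(* a/s = b/t iff u(at - bs) = 0 for some u outside P; R may have zero       *)
(* divisors, so the factor u is needed.                                       *)
Definition frac_eq (x y : fracs) : bool :=
  `[< exists2 u : R, u \notin P
      & u * (x.1 * val y.2 - y.1 * val x.2) = 0 >].

Lemma frac_eq_equiv : equiv_class_of frac_eq.
Proof.
split=> [x|x y|y x z].
- by apply/asboolP; exists 1; rewrite ?idealr1 // subrr mulr0.
- by apply/asboolP/asboolP => -[u uP e]; exists u => //;
    rewrite -opprB mulrN e oppr0.
- move=> /asboolP[u uP e1] /asboolP[v vP e2]; apply/asboolP.
  exists (u * v * val y.2).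
    by rewrite !prime_idealrM !negb_or uP vP (valP y.2).
  have -> : u * v * val y.2 * (x.1 * val z.2 - z.1 * val x.2) =
    v * val z.2 * (u * (x.1 * val y.2 - y.1 * val x.2)) +
    u * val x.2 * (v * (y.1 * val z.2 - z.1 * val y.2)) by ring.
  by rewrite e1 e2 !mulr0 addr0.
Qed.

Canonical frac_equivRel := EquivRelPack frac_eq_equiv.
Canonical frac_encModRel := defaultEncModRel frac_eq.

(* The ring R_P; mkfrac a s is the fraction a / s.                            *)
Definition localization : Type := {eq_quot frac_eq}.
HB.instance Definition _ : EqQuotient fracs frac_eq localization :=
  EqQuotient.on localization.
HB.instance Definition _ := Choice.on localization.

Definition mkfrac (a : R) (s : denom) : localization :=
  \pi_localization (a, s).

Lemma mkfracP (a b : R) (s t : denom) :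
  mkfrac a s = mkfrac b t <->
  exists2 u : R, u \notin P & u * (a * val t - b * val s) = 0.
Proof.
split=> [/eqmodP/asboolP //|h].
by apply/eqmodP/asboolP.
Qed.

Lemma mkfrac_surj (x : localization) : exists a s, x = mkfrac a s.
Proof. by exists (repr x).1, (repr x).2; rewrite /mkfrac -surjective_pairing reprK. Qed.

Definition loc_opp (x : localization) :=
  mkfrac (- (repr x).1) (repr x).2.
Definition loc_add (x y : localization) :=
  mkfrac ((repr x).1 * val (repr y).2 + (repr y).1 * val (repr x).2)
         (denomM (repr x).2 (repr y).2).
Definition loc_mul (x y : localization) :=
  mkfrac ((repr x).1 * (repr y).1) (denomM (repr x).2 (repr y).2).

Lemma repr_mkfrac a s : exists2 u : R, u \notin P &
  u * ((repr (mkfrac a s)).1 * val s - a * val (repr (mkfrac a s)).2) = 0.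
Proof.
apply/(mkfracP _ a _ s).
by rewrite /mkfrac -surjective_pairing reprK.
Qed.

Lemma loc_oppE a s : loc_opp (mkfrac a s) = mkfrac (- a) s.
Proof.
rewrite /loc_opp; have [u uP] := repr_mkfrac a s.
case: (repr _) => c r /= e; apply/mkfracP; exists u => //.
have -> : u * (- c * val s - - a * val r) = - (u * (c * val s - a * val r)) by ring.
by rewrite e oppr0.
Qed.

Lemma loc_addE a s b t :
  loc_add (mkfrac a s) (mkfrac b t) =
  mkfrac (a * val t + b * val s) (denomM s t).
Proof.
rewrite /loc_add; have [u uP] := repr_mkfrac a s.
case: (repr (mkfrac a s)) => c r /= e1; have [v vP] := repr_mkfrac b t.
case: (repr (mkfrac b t)) => d q /= e2; apply/mkfracP.
exists (u * v); first by rewrite prime_idealrM negb_or uP vP.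
rewrite /=.
have -> : u * v * ((c * val q + d * val r) * (val s * val t)
   - (a * val t + b * val s) * (val r * val q)) =
   v * val q * val t * (u * (c * val s - a * val r)) +
   u * val r * val s * (v * (d * val t - b * val q)) by ring.
by rewrite e1 e2 !mulr0 addr0.
Qed.

Lemma loc_mulE a s b t :
  loc_mul (mkfrac a s) (mkfrac b t) = mkfrac (a * b) (denomM s t).
Proof.
rewrite /loc_mul; have [u uP] := repr_mkfrac a s.
case: (repr (mkfrac a s)) => c r /= e1; have [v vP] := repr_mkfrac b t.
case: (repr (mkfrac b t)) => d q /= e2; apply/mkfracP.
exists (u * v); first by rewrite prime_idealrM negb_or uP vP.
rewrite /=.
have -> : u * v * (c * d * (val s * val t) - a * b * (val r * val q)) =
   v * d * val t * (u * (c * val s - a * val r)) +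
   u * a * val r * (v * (d * val t - b * val q)) by ring.
by rewrite e1 e2 !mulr0 addr0.
Qed.

Lemma mkfrac_eq (a b : R) (s t : denom) :
  a * val t = b * val s -> mkfrac a s = mkfrac b t.
Proof.
by move=> e; apply/mkfracP; exists 1; rewrite ?idealr1 // e subrr mulr0.
Qed.

Lemma loc_addA : associative loc_add.
Proof.
move=> x y z; have [[[a [s ->]] [b [t ->]]] [c [u ->]]] :=
  (mkfrac_surj x, mkfrac_surj y, mkfrac_surj z).
by rewrite !loc_addE; apply: mkfrac_eq => /=; ring.
Qed.

Lemma loc_addC : commutative loc_add.
Proof.
move=> x y; have [[a [s ->]] [b [t ->]]] := (mkfrac_surj x, mkfrac_surj y).
by rewrite !loc_addE; apply: mkfrac_eq => /=; ring.
Qed.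

Lemma loc_add0 : left_id (mkfrac 0 denom1) loc_add.
Proof.
move=> x; have [a [s ->]] := mkfrac_surj x.
by rewrite !loc_addE; apply: mkfrac_eq => /=; ring.
Qed.

Lemma loc_addN : left_inverse (mkfrac 0 denom1) loc_opp loc_add.
Proof.
move=> x; have [a [s ->]] := mkfrac_surj x.
by rewrite loc_oppE !loc_addE; apply: mkfrac_eq => /=; ring.
Qed.

HB.instance Definition _ :=
  GRing.isZmodule.Build localization loc_addA loc_addC loc_add0 loc_addN.

Lemma loc_mulA : associative loc_mul.
Proof.
move=> x y z; have [[[a [s ->]] [b [t ->]]] [c [u ->]]] :=
  (mkfrac_surj x, mkfrac_surj y, mkfrac_surj z).
by rewrite !loc_mulE; apply: mkfrac_eq => /=; ring.
Qed.

Lemma loc_mulC : commutative loc_mul.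
Proof.
move=> x y; have [[a [s ->]] [b [t ->]]] := (mkfrac_surj x, mkfrac_surj y).
by rewrite !loc_mulE; apply: mkfrac_eq => /=; ring.
Qed.

Lemma loc_mul1 : left_id (mkfrac 1 denom1) loc_mul.
Proof.
move=> x; have [a [s ->]] := mkfrac_surj x.
by rewrite !loc_mulE; apply: mkfrac_eq => /=; ring.
Qed.

Lemma loc_mulD : left_distributive loc_mul +%R.
Proof.
move=> x y z; have [[[a [s ->]] [b [t ->]]] [c [u ->]]] :=
  (mkfrac_surj x, mkfrac_surj y, mkfrac_surj z).
rewrite /GRing.add /= !(loc_addE, loc_mulE).
by apply: mkfrac_eq => /=; ring.
Qed.

Lemma loc_1neq0 : mkfrac 1 denom1 != 0.
Proof.
apply/eqP => /mkfracP[u uP] /=.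
by rewrite mul1r mul0r subr0 mulr1 => u0; rewrite u0 idealr0 in uP.
Qed.

HB.instance Definition _ := GRing.Zmodule_isComNzRing.Build localization
  loc_mulA loc_mulC loc_mul1 loc_mulD loc_1neq0.

End Localization.

Section CohenMacaulay.

Definition ideal_gen (R : comNzRingType) (s : seq R) : {pred R} :=
  [pred x | `[< exists c : 'I_(size s) -> R,
                  x = \sum_(i < size s) c i * s`_i >]].

Definition maximal_ideal (R : comNzRingType) (I : idealr R) : Prop :=
  forall J : idealr R, {subset I <= J} -> {subset J <= I}.

(* P 0 < P 1 < ... < P n is a strict chain of primes; P is ignored beyond n.  *)
Definition prime_chain (R : comNzRingType) (n : nat)
    (P : nat -> prime_idealr R) : Prop :=
  forall i, (i < n)%N -> {subset P i <= P i.+1} /\ ~ {subset P i.+1 <= P i}.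

Definition krull_dim (R : comNzRingType) (d : nat) : Prop :=
  (exists P : nat -> prime_idealr R, prime_chain d P) /\
  (forall n (P : nat -> prime_idealr R), prime_chain n P -> (n <= d)%N).

Definition regular_seq (R : comNzRingType) (s : seq R) : Prop :=
  (forall i x, (i < size s)%N ->
     s`_i * x \in ideal_gen (take i s) -> x \in ideal_gen (take i s)) /\
  1 \notin ideal_gen s.

(* The maximal ideal of a local ring is its set of non-units.                 *)
Definition nonunit (R : comNzRingType) (x : R) : Prop :=
  ~ exists y, y * x = 1.

Definition local_depth (R : comNzRingType) (d : nat) : Prop :=
  (exists s : seq R,
     [/\ size s = d, regular_seq s & forall x, x \in s -> nonunit x]) /\
  (forall s : seq R, regular_seq s -> (forall x, x \in s -> nonunit x) ->
     (size s <= d)%N).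

Definition local_cohen_macaulay (R : comNzRingType) : Prop :=
  exists d, krull_dim R d /\ local_depth R d.

(* As usual, this notion is meant for Noetherian R, in particular for         *)
(* quotients of polynomial rings over a field. Maximal ideals are prime, so   *)
(* it is no restriction that P ranges over prime_idealr.                      *)
Definition cohen_macaulay (R : comNzRingType) : Prop :=
  forall P : prime_idealr R, maximal_ideal P ->
    local_cohen_macaulay (localization P).

End CohenMacaulay.

Section FiniteLattice.
Context {disp : Order.disp_t} (L : finTBLatticeType disp).
Local Open Scope order_scope.

(* y covers x *)
Definition covers (x y : L) : bool :=
  (x < y) && [forall z : L, ~~ ((x < z) && (z < y))].

Definition atoms : {set L} := [set x | covers \bot x].

Definition mi : {set L} :=
  [set x | (x != \top) &&
     [forall a : L, forall b : L, (x == a `&` b) ==> (x == a) || (x == b)]].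

Definition atomic : Prop :=
  forall x : L, exists2 A : {set L}, A \subset atoms & x = \join_(a in A) a.

Lemma mi_sep (b : L) : b != \bot -> exists2 a, a \in mi & ~~ (b <= a).
Proof.
move=> b0; have bot_ok : ~~ (b <= \bot) by rewrite lex0.
case: (@arg_maxnP L \bot (fun a => ~~ (b <= a))
  (fun a => #|[set y | y <= a]|)) => // a ba amax.
exists a => //; rewrite inE; apply/andP; split.
  by apply: contraNneq ba => ->; rewrite lex1.
apply/forallP => c; apply/forallP => e; apply/implyP => /eqP ace.
suff above f : a <= f -> a != f -> b <= f.
  case: eqVneq => //= nac; case: eqVneq => //= nae.
  case/negP: ba; rewrite {1}ace lexI.
  by rewrite !above // ace ?leIl ?leIr.
move=> af naf; apply: contraT => bf; have /= := amax _ bf.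
rewrite leqNgt => /negP[]; apply/proper_card/properP; split.
  by apply/subsetP => y; rewrite !inE => /le_trans; apply.
exists f; rewrite !inE ?lexx //.
by apply: contraNN naf => fa; rewrite eq_le af fa.
Qed.

End FiniteLattice.

Section PhanIdeal.
Variables (k : fieldType) (disp : Order.disp_t) (L : finTBLatticeType disp).

(* S(L) = k[x_a | a \in mi L], where x_a is 'X_i for enum_val i = a.          *)
Local Notation S := {mpoly k[#|mi L|]}.

Definition phan_gen (b : L) : S :=
  \prod_(i < #|mi L| | ~~ (b <= enum_val i)%O) 'X_i.

Definition phan_ideal : {pred S} :=
  ideal_gen [seq phan_gen b | b in atoms L].

Lemma phan_gen_coeff0 b : b \in atoms L -> (phan_gen b)@_0%MM = 0.
Proof.
rewrite inE => /andP[b0 _].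
have [|a ami ba] := @mi_sep _ L b; first by rewrite -lt0x.
rewrite /phan_gen (bigD1 (enum_rank_in ami a)) ?enum_rankK_in //=.
by rewrite -[_@_0%MM]/(mcoeff 0%MM _) rmorphM /= mcoeffX mnm1_eq0 mul0r.
Qed.

Lemma phan_ideal_closed : idealr_closed phan_ideal.
Proof.
split.
- apply/asboolP; exists (fun=> 0).
  by rewrite big1 // => i _; rewrite mul0r.
- apply/asboolP => -[c] /(congr1 (mcoeff 0%MM)) /eqP.
  rewrite raddf_sum /= mcoeff1 eqxx big1 ?oner_eq0 // => i _.
  rewrite rmorphM /= (nth_map \bot%O) -?(size_map phan_gen) //.
  rewrite phan_gen_coeff0 ?mulr0 // -mem_enum mem_nth //.
  by rewrite -(size_map phan_gen).
- move=> a u v /asboolP[c ->] /asboolP[e ->]; apply/asboolP.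
  exists (fun i => a * c i + e i); rewrite mulr_sumr -big_split /=.
  by apply: eq_bigr => i _; rewrite mulrDl mulrA.
Qed.

HB.instance Definition _ := isIdealr.Build S phan_ideal phan_ideal_closed.

End PhanIdeal.
Arguments phan_gen k {disp L} b.
Arguments phan_ideal k {disp} L.

(* Order-theoretic notions in the subset P of T, ordered by le.               *)
Section Modular.
Variables (T : Type) (P : T -> Prop) (le : rel T).

Definition is_bottom_in (x : T) : Prop := P x /\ forall y, P y -> le x y.

(* y covers x *)
Definition covers_in (x y : T) : Prop :=
  [/\ P x, P y, le x y, x <> y &
      forall z, P z -> le x z -> le z y -> z = x \/ z = y].

Definition is_meet_in (x y w : T) : Prop :=
  [/\ P w, le w x, le w y & forall z, P z -> le z x -> le z y -> le z w].

Definition is_join_in (x y j : T) : Prop :=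
  [/\ P j, le x j, le y j & forall z, P z -> le x z -> le y z -> le j z].

Definition graded_by (rk : T -> int) : Prop :=
  [/\ forall x y, P x -> P y -> le x y -> rk x <= rk y,
      forall x, is_bottom_in x -> rk x = 0 &
      forall x y, covers_in x y -> rk y = rk x + 1].

Definition modular : Prop :=
  exists2 rk : T -> int, graded_by rk &
    forall x y w j, P x -> P y -> is_meet_in x y w -> is_join_in x y j ->
      rk x + rk y = rk w + rk j.

End Modular.

Section LcmLattice.
Variables (k : fieldType) (n : nat) (I : {pred {mpoly k[n]}}).

(* The minimal monomial generators of a monomial ideal I are the monomials of *)
(* I that are minimal for divisibility.                                       *)
Definition min_gen (m : 'X_{1..n}) : Prop :=
  'X_[m] \in I /\
  forall m' : 'X_{1..n}, 'X_[m'] \in I -> (m' <= m)%MM -> m' = m.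

Definition lcm_lattice (m : 'X_{1..n}) : Prop :=
  exists2 s : seq 'X_{1..n}, forall g, g \in s -> min_gen g &
    m = \big[@mlcm n/0%MM]_(g <- s) g.

Definition divides (m1 m2 : 'X_{1..n}) : bool := (m1 <= m2)%MM.

Definition lcm_lattice_modular : Prop := modular lcm_lattice divides.

End LcmLattice.

(* Main.v *)
Require Import Defs.
From HB Require Import structures.
From mathcomp Require Import all_boot all_order all_algebra.
From mathcomp Require Import ring zify.
From mathcomp Require Import boolp.
From mathcomp Require Import mpoly.
From mathcomp Require classical_sets.

(* In a modular atomic lattice L of rank r the n meet-irreducibles are the
   coatoms, and M(L) consists of the polynomials all of whose monomials meet
   every "basis": a set of r coatoms with meet 0. The bases satisfy the exchange
   axiom of a matroid, so that passing to I : x_j and I + (x_j) repeatedly filters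
   S/I by copies of the quotients S/(x_j | j in B), B a basis.

   Let P be a maximal ideal, d = n - r. By Zariski's lemma P contains a nonzero
   y_j = f_j(x_j) for each j, with y_j = x_j whenever x_j lies in P. Bases not
   contained in {j | x_j in P} disappear after localization. On the quotients
   for the remaining bases the elementary symmetric polynomials
   e_d(y), ..., e_1(y) form a regular sequence: e_d is the product of the y_j not
   in the basis, and modulo e_d one removes these y_j one at a time. Hence they
   form a regular sequence of length d on (S/I)_P.

   A regular sequence of length d in any ring gives a chain of primes of length
   d. Conversely, a prime containing I contains (x_j | j in B) for a basis B, and
   counting monomials bounds chains above it by d. Hence dimension and depth of
   (S/I)_P are both d. *)

Set Implicit Arguments.
Unset Strict Implicit.
Unset Printing Implicit Defensive.

Import Order.TTheory GRing.Theory Num.Theory.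
Local Open Scope ring_scope.
Local Open Scope quotient_scope.

(** * Weakly regular sequences *)

Section WeaklyRegular.
Variable R : comNzRingType.
Implicit Types (J K : R -> Prop) (a x : R) (g : seq R).

(** Unlike [idealr], this allows the unit ideal, which arises when quotients vanish. *)
Definition is_ideal J :=
  [/\ J 0, forall x y, J x -> J y -> J (x + y) & forall a x, J x -> J (a * x)].

Definition add_elt J a : R -> Prop := fun x => exists y, J (x - a * y).
Definition colon J a : R -> Prop := fun x => J (a * x).

Fixpoint weakly_regular J g : Prop :=
  if g is a :: g' then
    (forall x, J (a * x) -> J x) /\ weakly_regular (add_elt J a) g'
  else True.

Lemma pred_ext J K : (forall x, J x <-> K x) -> J = K.
Proof. by move=> e; apply: funext => x; apply: propext. Qed.

Lemma ideal_zero J : is_ideal J -> J 0. Proof. by case. Qed.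
Lemma ideal_add J x y : is_ideal J -> J x -> J y -> J (x + y).
Proof. by case=> _ h _; apply: h. Qed.
Lemma ideal_mull J a x : is_ideal J -> J x -> J (a * x).
Proof. by case=> _ _; apply. Qed.
Lemma ideal_mulr J a x : is_ideal J -> J x -> J (x * a).
Proof. by rewrite mulrC; apply: ideal_mull. Qed.
Lemma ideal_opp J x : is_ideal J -> J x -> J (- x).
Proof. by rewrite -mulN1r; apply: ideal_mull. Qed.
Lemma ideal_sub J x y : is_ideal J -> J x -> J y -> J (x - y).
Proof. by move=> iJ Jx Jy; apply: ideal_add => //; apply: ideal_opp. Qed.
Lemma ideal_sum J (I : Type) (r : seq I) (P : pred I) (F : I -> R) :
  is_ideal J -> (forall i, P i -> J (F i)) -> J (\sum_(i <- r | P i) F i).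
Proof.
by move=> iJ h; apply: big_ind => //; [apply: ideal_zero|move=> x y; apply: ideal_add].
Qed.
Lemma ideal_subl J x y : is_ideal J -> J (x - y) -> J y -> J x.
Proof. by move=> iJ h Jy; rewrite -(subrK y x); apply: ideal_add. Qed.

Lemma add_elt_ideal J a : is_ideal J -> is_ideal (add_elt J a).
Proof.
move=> iJ; split=> [|x y [u Ju] [v Jv]|b x [u Ju]].
- by exists 0; rewrite mulr0 subr0; apply: ideal_zero.
- exists (u + v); have -> : x + y - a * (u + v) = (x - a * u) + (y - a * v) by ring.
  exact: ideal_add.
- exists (b * u); have -> : b * x - a * (b * u) = b * (x - a * u) by ring.
  exact: ideal_mull.
Qed.

Lemma add_elt_sub J a x : J x -> add_elt J a x.
Proof. by exists 0; rewrite mulr0 subr0. Qed.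

Lemma add_elt_in J a y : is_ideal J -> add_elt J a (a * y).
Proof. by exists y; rewrite subrr; apply: ideal_zero. Qed.

Lemma add_eltC J a b : add_elt (add_elt J a) b = add_elt (add_elt J b) a.
Proof.
apply: pred_ext => x; split=> -[y [z h]]; exists z, y;
  by rewrite -addrA [- _ - _]addrC addrA.
Qed.

(* Regularity is inherited by extensions, here for
   0 -> R/(J : x) -> R/J -> R/(J + x) -> 0. *)
Lemma weakly_regular_colon J x g : is_ideal J ->
  weakly_regular (colon J x) g -> weakly_regular (add_elt J x) g ->
  weakly_regular J g.
Proof.
elim: g J => //= a g IH J iJ [nzc wc] [nza wa].
have iJx := add_elt_ideal x iJ.
split=> [y Jay|].
  have [z Jz] : add_elt J x y by apply: nza; apply: add_elt_sub.
  apply: (ideal_subl iJ Jz); apply: nzc; rewrite /colon.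
  have -> : x * (a * z) = a * y - a * (y - x * z) by ring.
  by apply: ideal_sub => //; apply: ideal_mull.
apply: IH; first exact: add_elt_ideal.
  (* Since a is regular modulo J + (x), forming J : x commutes with adding a. *)
  suff <- : add_elt (colon J x) a = colon (add_elt J a) x by [].
  apply: pred_ext => y; split=> -[z Jz]; rewrite /colon in Jz *.
    exists (x * z); rewrite mulrCA -mulrBr //.
  have [v Jv] : add_elt J x z.
    apply: nza; exists y; have -> : a * z - x * y = - (x * y - a * z) by ring.
    exact: ideal_opp.
  exists v; rewrite /colon.
  have -> : x * (y - a * v) = x * y - a * z + a * (z - x * v) by ring.
  by apply: ideal_add => //; apply: ideal_mull.
by rewrite add_eltC.
Qed.

Lemma weakly_regularT J g : (forall x, J x) -> weakly_regular J g.
Proof.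
elim: g J => //= a g IH J h; split=> //; apply: IH => x.
exact: add_elt_sub.
Qed.

End WeaklyRegular.

(** * Elementary symmetric polynomials as a regular sequence *)

Section ElementarySymmetric.
Variables (R : comNzRingType) (n : nat) (y : 'I_n -> R).

Definition span_elts (C : {set 'I_n}) : R -> Prop :=
  fun x => exists q : 'I_n -> R, x = \sum_(c in C) q c * y c.

Definition elem_sym t := \sum_(A : {set 'I_n} | #|A| == t) \prod_(i in A) y i.

(** Highest degree first: e_t, ..., e_1. *)
Fixpoint elem_syms t := if t is t'.+1 then elem_sym t :: elem_syms t' else [::].

Lemma span_elts_ideal C : is_ideal (span_elts C).
Proof.
split=> [|x z [q ->] [p ->]|a x [q ->]].
- by exists (fun=> 0); rewrite big1 // => i _; rewrite mul0r.
- exists (fun i => q i + p i); rewrite -big_split /=.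
  by apply: eq_bigr => i _; rewrite mulrDl.
- exists (fun i => a * q i); rewrite mulr_sumr.
  by apply: eq_bigr => i _; rewrite mulrA.
Qed.

Lemma span_elts_mem (C : {set 'I_n}) j : j \in C -> span_elts C (y j).
Proof.
move=> jC; exists (fun i => (i == j)%:R).
rewrite (bigD1 j) //= eqxx mul1r big1 ?addr0 // => i /andP[_ /negPf->].
by rewrite mul0r.
Qed.

Lemma add_span_elts (C : {set 'I_n}) j : j \notin C ->
  add_elt (span_elts C) (y j) = span_elts (j |: C).
Proof.
move=> jC; apply: pred_ext => x; split=> [[z [q e]]|[q ->]].
  exists (fun i => if i == j then z else q i).
  rewrite big_setU1 //= eqxx -(subrK (y j * z) x) e addrC mulrC; congr (_ + _).
  by apply: eq_bigr => i iC; case: eqP iC jC => // -> ->.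
exists (q j), q; rewrite big_setU1 //=; ring.
Qed.

Hypothesis y_regular : forall (C : {set 'I_n}) j x, j \notin C ->
  span_elts C (y j * x) -> span_elts C x.

Lemma prod_regular (C : {set 'I_n}) (A : {set 'I_n}) x : [disjoint A & C] ->
  span_elts C ((\prod_(i in A) y i) * x) -> span_elts C x.
Proof.
elim: {A}#|A| {-2}A (erefl #|A|) x => [|m IH] A.
  by move/eqP; rewrite cards_eq0 => /eqP-> x _; rewrite big_set0 mul1r.
move=> cA x dA.
have /card_gt0P[j jA] : (0 < #|A|)%N by rewrite cA.
rewrite (big_setD1 j) //= -mulrA => /y_regular h.
apply: (IH (A :\ j)); last first.
- by apply: h; rewrite (disjointFr dA jA).
- by apply: disjointWl dA; apply: subD1set.
- by move: cA; rewrite (cardsD1 j) jA => -[].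
Qed.

(** Let a be the product over A without j, and J = (y_c | c in C) + (y_j a). As y_j is regular
    modulo C, J : y_j is the ideal for the smaller product a, while J + (y_j) is the span of j and
    C. Hence [weakly_regular_colon] and induction on A apply. *)
Lemma weakly_regular_add_prod (C A : {set 'I_n}) g : [disjoint A & C] ->
  (forall j, j \in A -> weakly_regular (span_elts (j |: C)) g) ->
  weakly_regular (add_elt (span_elts C) (\prod_(i in A) y i)) g.
Proof.
have iC := span_elts_ideal C.
elim: {A}#|A| {-2}A (erefl #|A|) => [|m IH] A.
  move/eqP; rewrite cards_eq0 => /eqP-> _ _; apply: weakly_regularT => x.
  by rewrite big_set0; exists x; rewrite mul1r subrr; apply: ideal_zero.
move=> cA dA h.
have /card_gt0P[j jA] : (0 < #|A|)%N by rewrite cA.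
have jC : j \notin C by rewrite (disjointFr dA jA).
have cA' : #|A :\ j| = m by move: cA; rewrite (cardsD1 j) jA => -[].
rewrite (big_setD1 j) //=.
apply: (@weakly_regular_colon _ _ (y j)); first exact: add_elt_ideal.
  suff -> : colon (add_elt (span_elts C) (y j * \prod_(i in A :\ j) y i)) (y j)
    = add_elt (span_elts C) (\prod_(i in A :\ j) y i).
    apply: IH => //; first by apply: disjointWl dA; apply: subD1set.
    by move=> i; rewrite inE => /andP[_ iA]; apply: h.
  apply: pred_ext => x; split=> -[z Jz]; exists z.
    by apply: (y_regular jC); rewrite mulrBr mulrA.
  by rewrite -mulrA -mulrBr; apply: ideal_mull.
suff -> : add_elt (add_elt (span_elts C) (y j * \prod_(i in A :\ j) y i)) (y j)
   = span_elts (j |: C) by apply: h.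
rewrite -add_span_elts //; apply: pred_ext => x; split=> [[z [w Jw]]|[z Jz]].
  exists (z + w * \prod_(i in A :\ j) y i).
  by rewrite mulrDr opprD addrA [w * _]mulrC mulrA.
by exists z; apply: add_elt_sub.
Qed.

(* Modulo the y_c, c in C, the top elementary symmetric polynomial is the
   product of the remaining y's, and dividing by it is filtered by dividing by
   one y at a time. *)
Lemma weakly_regular_elem_syms (C : {set 'I_n}) t : (#|C| + t)%N = n ->
  weakly_regular (span_elts C) (elem_syms t).
Proof.
elim: t C => //= t IH C cC.
have iC := span_elts_ideal C.
have dC : [disjoint ~: C & C] by rewrite disjoint_sym disjoints_subset setCK.
have cC' : #|~: C| = t.+1.
  by apply/eqP; rewrite -(eqn_add2l #|C|) cardsC card_ord cC.
(* Only t+1 indices lie outside C, so every other term of e_(t+1) contains some y_c with c in C. *)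
have eS : span_elts C (elem_sym t.+1 - \prod_(i in ~: C) y i).
  rewrite /elem_sym (bigD1 (~: C)) /= ?cC' //.
  rewrite addrAC subrr add0r; apply: ideal_sum => // A /andP[/eqP cA nA].
  have /existsP[j /andP[jA jC]] : [exists j, (j \in A) && (j \in C)].
    apply: contraNT nA => /existsPn h.
    rewrite eqEcard cA cC' leqnn andbT; apply/subsetP => j jA; rewrite inE.
    by have := h j; rewrite jA.
  by rewrite (bigD1 j) //=; apply: ideal_mulr => //; apply: span_elts_mem.
have e2 : add_elt (span_elts C) (elem_sym t.+1) =
    add_elt (span_elts C) (\prod_(i in ~: C) y i).
  apply: pred_ext => x; split=> -[z Jz]; exists z.
    have -> : x - \prod_(i in ~: C) y i * z = (x - elem_sym t.+1 * z) +
      (elem_sym t.+1 - \prod_(i in ~: C) y i) * z by ring.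
    by apply: ideal_add => //; apply: ideal_mulr.
  have -> : x - elem_sym t.+1 * z = (x - \prod_(i in ~: C) y i * z) -
      (elem_sym t.+1 - \prod_(i in ~: C) y i) * z by ring.
  by apply: ideal_sub => //; apply: ideal_mulr.
split=> [x Jx|].
  apply: (prod_regular dC).
  have -> : \prod_(i in ~: C) y i * x = elem_sym t.+1 * x -
    (elem_sym t.+1 - \prod_(i in ~: C) y i) * x by ring.
  by apply: ideal_sub => //; apply: ideal_mulr.
rewrite e2; apply: weakly_regular_add_prod => // j; rewrite inE => jC.
by apply: IH; rewrite cardsU1 jC /= add1n addSnnS.
Qed.

End ElementarySymmetric.

(** * Prime ideals and chains *)

Section PrimeIdeals.
Variable R : comNzRingType.
Implicit Types (J K T : R -> Prop).

Definition is_prime J := [/\ is_ideal J, ~ J 1 & forall x y, J (x * y) -> J x \/ J y].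

(** An ideal maximal among those containing J and missing the multiplicative set T is prime; Zorn's
    lemma supplies one. *)
Lemma exists_prime_avoiding J T : is_ideal J -> T 1 ->
  (forall x y, T x -> T y -> T (x * y)) -> (forall x, T x -> ~ J x) ->
  exists Q, [/\ is_prime Q, forall x, J x -> Q x & forall x, T x -> ~ Q x].
Proof.
move=> iJ T1 TM dJ.
pose X := {K : R -> Prop |
  [/\ is_ideal K, forall x, J x -> K x & forall x, T x -> ~ K x]}.
have pJ : [/\ is_ideal J, forall x, J x -> J x & forall x, T x -> ~ J x] by split.
pose t0 : X := exist _ J pJ.
pose le (K1 K2 : X) := `[< forall x, sval K1 x -> sval K2 x >].
have le_refl t : le t t by apply/asboolP.
have le_trans r s t : le r s -> le s t -> le r t.
  by move=> /asboolP rs /asboolP st; apply/asboolP => x /rs/st.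
have [A Atot|[Q pQ] mQ] :=
  classical_sets.ZL_preorder t0 le_refl le_trans.
(* A nonempty chain is bounded by its union, the empty one by J. *)
- have [[a0 Aa0]|nA] := pselect (exists a, A a); last first.
    by exists t0 => s As; case: nA; exists s.
  pose U x := exists2 K : X, A K & sval K x.
  have pU : [/\ is_ideal U, forall x, J x -> U x & forall x, T x -> ~ U x].
    split.
    + split=> [|x y [K1 A1 K1x] [K2 A2 K2y]|a x [K AK Kx]].
      * by exists a0 => //; case: (svalP a0) => /ideal_zero.
      * have [/asboolP h|/asboolP h] := Atot _ _ A1 A2.
          exists K2 => //; case: (svalP K2) => i2 _ _.
          by apply: ideal_add => //; apply: h.
        by exists K1 => //; case: (svalP K1) => i2 _ _; apply: ideal_add => //; apply: h.
      * by exists K => //; case: (svalP K) => iK _ _; apply: ideal_mull.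
    + by move=> x Jx; exists a0 => //; case: (svalP a0) => _ h _; apply: h.
    + by move=> x Tx [K AK Kx]; case: (svalP K) => _ _ h; apply: (h x).
  exists (exist _ U pU) => s As; apply/asboolP => x sx; exists s => //.
have [iQ JQ disjQ] := pQ.
exists Q; split=> //; split=> // [|x y Qxy]; first exact: disjQ.
(* By maximality, Q + (z) meets T for z outside Q; two such elements with product in Q would bring
   an element of T into Q. *)
have meet z : ~ Q z -> exists2 t, T t & add_elt Q z t.
  move=> nQz; apply: contrapT => h.
  have pz : [/\ is_ideal (add_elt Q z), forall x, J x -> add_elt Q z x &
      forall x, T x -> ~ add_elt Q z x].
    split; first exact: add_elt_ideal.
      by move=> w /JQ; apply: add_elt_sub.
    by move=> w Tw aw; apply: h; exists w.
  have /asboolP/= le1 := mQ (exist _ _ pz)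
    (introT (asboolP _) (fun x => @add_elt_sub _ Q z x)).
  by apply: nQz; apply: le1; exists 1; rewrite mulr1 subrr; apply: ideal_zero.
apply: contrapT => /not_orP[/meet[t Tt [u Qu]] /meet[s Ts [v Qv]]].
apply: (disjQ _ (TM _ _ Tt Ts)).
have -> : t * s = (t - x * u) * s + x * u * (s - y * v) + (x * y) * (u * v) by ring.
apply: ideal_add => //; last exact: ideal_mulr.
by apply: ideal_add => //; [apply: ideal_mulr|apply: ideal_mull].
Qed.

Lemma is_prime_prime_idealr J : is_prime J ->
  exists P : prime_idealr R, forall x, (x \in P) <-> J x.
Proof.
move=> [iJ J1 JM].
pose S : {pred R} := fun x => `[< J x >].
have S_in x : (x \in S) = `[< J x >] by [].
have Sc : idealr_closed S.
  split; rewrite ?S_in.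
  - by apply/asboolP; apply: ideal_zero.
  - exact/asboolP.
  - move=> a u v; rewrite !S_in => /asboolP Ju /asboolP Jv; apply/asboolP.
    by apply: ideal_add => //; apply: ideal_mull.
have Sp : prime_idealr_closed S.
  move=> u v; rewrite !S_in => /asboolP/JM[] h; apply/orP; [left|right];
  exact/asboolP.
pose m1 := isIdealr.Build R S Sc.
pose m2 := isPrimeIdealrClosed.Build R S Sp.
pose P : prime_idealr R := HB.pack S m1 m2.
by exists P => x; split=> /asboolP.
Qed.

Lemma prime_idealr_is_prime (P : prime_idealr R) : is_prime (fun x => x \in P).
Proof.
split=> [||x y]; last by rewrite prime_idealrM => /orP.
  split=> [|x y|a x]; [exact: idealr0|exact: rpredD|exact: idealMr].
by rewrite idealr1.
Qed.

Fixpoint add_elts J (s : seq R) :=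
  if s is a :: s' then add_elts (add_elt J a) s' else J.

Lemma add_elts_rcons J s a : add_elts J (rcons s a) = add_elt (add_elts J s) a.
Proof. by elim: s J => //= b s IH J. Qed.

Lemma add_elts_ideal J s : is_ideal J -> is_ideal (add_elts J s).
Proof. by elim: s J => //= a s IH J iJ; apply: IH; apply: add_elt_ideal. Qed.

Lemma weakly_regular_rcons J s a : weakly_regular J (rcons s a) <->
  weakly_regular J s /\ (forall x, add_elts J s (a * x) -> add_elts J s x).
Proof.
elim: s J => [|b s IH] J /=; first by split=> -[].
by split=> [[h /IH[]]|[[h ?] ?]]; split=> //; apply/IH.
Qed.

(* An element x of a minimal prime Q over J would be a zero divisor modulo J;
   hence below any prime containing J and an x regular modulo J there is a
   smaller one still containing J. *)
Lemma prime_below_regular J Q x : is_ideal J -> is_prime Q ->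
  (forall y, J y -> Q y) -> (forall y, J (x * y) -> J y) ->
  exists Q', [/\ is_prime Q', forall y, J y -> Q' y, forall y, Q' y -> Q y & ~ Q' x].
Proof.
move=> iJ [iQ Q1 QM] JQ rx.
have rxn n y : J (x ^+ n * y) -> J y.
  by elim: n y => [|n IH] y; rewrite ?mul1r // exprS -mulrA => /rx/IH.
(* Powers of x times elements outside Q: this set misses J because x is regular modulo J, and a
   prime missing it lies in Q and omits x. *)
pose T z := exists n u, ~ Q u /\ z = x ^+ n * u.
have [|w z [n [u [Qu ->]]] [m [v [Qv ->]]]|
    w [n [u [Qu ->]]] /rxn /JQ //|Q' [pQ' JQ' dQ']] :=
    @exists_prime_avoiding J T iJ.
- by exists 0%N, 1; rewrite mulr1.
- exists (n + m)%N, (u * v); split; first by move=> /QM[].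
  by rewrite exprD; ring.
exists Q'; split=> // [y Q'y|].
  apply: contrapT => Qy; apply: (dQ' y) => //.
  by exists 0%N, y; rewrite mul1r.
by apply: dQ'; exists 1%N, 1; rewrite mulr1.
Qed.

(** The chain is built downwards from Q, taking elements off the end of s: [prime_below_regular]
    gives a smaller prime that omits the element just removed but still contains the rest. *)
Lemma chain_of_regular J s Q : is_ideal J -> weakly_regular J s -> is_prime Q ->
  (forall x, add_elts J s x -> Q x) ->
  exists P : nat -> R -> Prop, [/\ forall i, (i <= size s)%N -> is_prime (P i),
    P (size s) = Q &
    forall i, (i < size s)%N -> (forall x, P i x -> P i.+1 x) /\
       exists x, P i.+1 x /\ ~ P i x].
Proof.
move=> iJ; elim/last_ind: s Q => [|s a IH] Q.
  by move=> _ pQ _; exists (fun=> Q); split.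
move=> /weakly_regular_rcons[ws ra] pQ sQ; rewrite add_elts_rcons in sQ.
have iA := add_elts_ideal s iJ.
have [|Q' [pQ' JQ' Q'Q nQ']] := prime_below_regular iA pQ _ ra.
  by move=> y Jy; apply: sQ; apply: add_elt_sub.
have [P [pP eP sP]] := IH _ ws pQ' JQ'.
exists (fun i => if (i <= size s)%N then P i else Q); rewrite size_rcons.
split=> [i||i]; first by case: (leqP i (size s)) => // /pP.
  by rewrite ltnn.
rewrite ltnS => le_i; rewrite le_i; case: ltnP => [lt_i|ge_i]; first exact: sP.
have -> : i = size s by apply/eqP; rewrite eqn_leq le_i.
rewrite eP; split=> //; exists a; split=> //.
by apply: sQ; exists 1; rewrite mulr1 subrr; apply: ideal_zero.
Qed.

(** Coefficients are indexed by nat so that lengthening the list does not change their type. *)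
Lemma ideal_genP (s : seq R) x : x \in ideal_gen s <->
  exists c : nat -> R, x = \sum_(i < size s) c i * s`_i.
Proof.
split=> [/asboolP[c ->]|[c ->]]; last by apply/asboolP; exists (fun i => c i).
exists (fun i => oapp c 0 (insub i)).
by apply: eq_bigr => i _; rewrite valK.
Qed.

Lemma ideal_genE (s : seq R) :
  (fun x => x \in ideal_gen s : Prop) = add_elts (fun x => x = 0) s.
Proof.
elim/last_ind: s => [|s a IH].
  apply: pred_ext => x; split=> [/ideal_genP[c ->]|->]; first by rewrite big_ord0.
  by apply/ideal_genP; exists (fun=> 0); rewrite big_ord0.
have gE (c : nat -> R) : \sum_(i < size (rcons s a)) c i * (rcons s a)`_i =
    \sum_(i < size s) c i * s`_i + c (size s) * a.
  rewrite size_rcons big_ord_recr /= nth_rcons ltnn eqxx; congr (_ + _).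
  by apply: eq_bigr => i _; rewrite nth_rcons ltn_ord.
rewrite add_elts_rcons -IH; apply: pred_ext => x; split=> [/ideal_genP[c ->]|].
  by exists (c (size s)); rewrite (gE c) mulrC addrK; apply/ideal_genP; exists c.
case=> y /ideal_genP[c e]; apply/ideal_genP.
exists (fun i => if i == size s then y else c i).
rewrite (gE (fun i => if i == size s then y else c i)) eqxx.
rewrite -[LHS](subrK (a * y)) e [y * a]mulrC; congr (_ + _).
by apply: eq_bigr => i _; rewrite ltn_eqF.
Qed.

Lemma zero_ideal : is_ideal (fun x : R => x = 0).
Proof. by split=> [//|x y -> ->|a x ->]; rewrite ?addr0 ?mulr0. Qed.

Lemma regular_seqE (s : seq R) : regular_seq s <->
  weakly_regular (fun x => x = 0) s /\ ~ add_elts (fun x => x = 0) s 1.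
Proof.
rewrite -ideal_genE /regular_seq.
suff h : (forall i x, (i < size s)%N -> s`_i * x \in ideal_gen (take i s) ->
   x \in ideal_gen (take i s)) <-> weakly_regular (fun x => x = 0) s.
  by split=> -[/h ? /negP ?].
elim/last_ind: s => [|s a IH]; first by split.
rewrite weakly_regular_rcons -IH size_rcons -ideal_genE.
split=> [h|[h1 h2] i x].
  split=> [i x lt_i|x].
    have := h i x (ltnW lt_i); rewrite nth_rcons lt_i -cats1 takel_cat //.
    exact: ltnW.
  have := h (size s) x (ltnSn _); rewrite nth_rcons ltnn eqxx.
  by rewrite -cats1 takel_cat // take_size.
rewrite ltnS leq_eqVlt nth_rcons -cats1 => /predU1P[->|lt_i].
  by rewrite ltnn eqxx takel_cat // take_size; apply: h2.
by rewrite lt_i takel_cat ?(ltnW lt_i) //; apply: h1.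
Qed.

(** As (s) is proper, some prime contains it; this is the top of the chain. It gives both a lower
    bound for the dimension and an upper bound for the depth. *)
Lemma regular_seq_prime_chain (s : seq R) : regular_seq s ->
  exists P : nat -> prime_idealr R, prime_chain (size s) P.
Proof.
move=> /regular_seqE[ws s1].
have [|x y -> ->|x -> //|Q [pQ sQ _]] :=
  @exists_prime_avoiding _ (fun x => x = 1) (add_elts_ideal s zero_ideal).
- by [].
- by rewrite mulr1.
have [P [pP _ sP]] := chain_of_regular zero_ideal ws pQ sQ.
have /choice[F hF] i : exists Pi : prime_idealr R,
    (i <= size s)%N -> forall x, x \in Pi <-> P i x.
  case: (leqP i (size s)) => [/pP/is_prime_prime_idealr[Pi hPi]|_].
    by exists Pi.
  by have [Pi _] := is_prime_prime_idealr pQ; exists Pi.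
exists F => i lt_i; have [sub [x [Px nPx]]] := sP i lt_i.
have e1 := hF i (ltnW lt_i); have e2 := hF i.+1 lt_i; split.
  by move=> y /e1/sub/e2.
by move=> h; apply/nPx/e1/h/e2.
Qed.

End PrimeIdeals.

Lemma prime_preimage (A Q : comNzRingType) (f : {rmorphism A -> Q})
    (J : Q -> Prop) :
  is_prime J -> is_prime (fun x => J (f x)).
Proof.
move=> [[J0 JD JM] J1 Jp]; split=> [||x y]; rewrite ?rmorph1 ?rmorphM //; last exact: Jp.
split=> [|x y|a x]; rewrite ?rmorph0 ?rmorphD ?rmorphM //; [exact: JD|exact: JM].
Qed.

(** * Zariski's lemma *)

Section Goldman.
Variable K : idomainType.

(** The image of [f] is a Goldman domain: inverting the single element [f s] turns it into a
    field. *)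
Definition goldman (R : comNzRingType) (f : {rmorphism R -> K}) :=
  exists2 s, f s != 0 &
    forall x, f x != 0 -> exists N y, f (x * y) = f s ^+ N.

Section Adjunction.
Variables (R : comNzRingType) (f : {rmorphism R -> K}) (a : K).

(** Evaluation at a; its image is the subring f(R)[a] of K. *)
Definition adjunction : {poly R} -> K := horner_morph (fun x => mulrC a (f x)).
HB.instance Definition _ := GRing.RMorphism.on adjunction.

Lemma adjunctionE p : adjunction p = (map_poly f p).[a]. Proof. by []. Qed.

Lemma adjunctionC c : adjunction c%:P = f c.
Proof. by rewrite adjunctionE map_polyC hornerC. Qed.

Lemma adjunction_horner V W :
  (map_poly f V).[adjunction W] = adjunction ((map_poly polyC V).[W]).
Proof.
rewrite -horner_map -map_poly_comp; congr (_.[_]).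
by apply: eq_map_poly => c /=; rewrite adjunctionC.
Qed.

(* If a is transcendental then R[a] is a polynomial ring, in which 1 + X s
   never divides a power of s. *)
Lemma goldman_algebraic : goldman adjunction ->
  exists2 p, map_poly f p != 0 & root (map_poly f p) a.
Proof.
move=> [F /= F0 hF]; apply: contrapT => trans.
have inj p : adjunction p = 0 -> map_poly f p = 0.
  move=> e; apply/eqP; apply: contrapT => /negP p0; apply: trans; exists p => //.
  by apply/rootP; rewrite -adjunctionE.
have G0 : map_poly f F != 0.
  by apply: contraNneq F0 => e; rewrite adjunctionE e horner0.
have [|N [Y e]] := hF (1 + 'X * F).
  apply/eqP => /inj /(congr1 (coefp 0)) /=.
  rewrite rmorphD rmorphM rmorph1 /= map_polyX coefD coef1 coefXM coef0 addr0.
  by apply/eqP; rewrite oner_eq0.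
set u := 'X * map_poly f F.
have {}e : (1 + u) * map_poly f Y = map_poly f F ^+ N.
  have : map_poly f ((1 + 'X * F) * Y - F ^+ N) = 0.
    by apply: inj; rewrite rmorphB /= e rmorphXn /= subrr.
  by rewrite rmorphB rmorphM rmorphD rmorph1 rmorphM rmorphXn /= map_polyX => /subr0_eq.
(* By [e], 1 + u divides F^N and hence u^N = X^N F^N; but u is -1 modulo 1 + u, so 1 + u would be a
   unit in spite of its positive degree. *)
have [Z eZ] : exists Z, u ^+ N = (-1) ^+ N + (1 + u) * Z.
  elim: (N) => [|M [Z eZ]]; first by exists 0; rewrite mulr0 addr0.
  exists ((-1) ^+ M + u * Z); rewrite exprS eZ exprS; ring.
have : (1 + u) * ((-1) ^+ N * ('X^N * map_poly f Y - Z)) = 1.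
  rewrite mulrCA mulrBr mulrCA e -exprMn -/u eZ addrK -exprMn mulrNN mulr1.
  exact: expr1n.
have s1u : (1 < size (1 + u)%R)%N.
  rewrite addrC size_polyDl size_mul ?polyX_eq0 // size_polyX ?size_poly1 /=;
  by rewrite ltnS lt0n size_poly_eq0.
set T := (_ * (_ - _)) => /(congr1 (size \o polyseq)) /=.
case: (eqVneq T 0) => [->|T0]; first by rewrite mulr0 size_poly0 size_poly1.
rewrite size_mul // ?size_poly1; last by rewrite -size_poly_gt0 (ltnW s1u).
have : (0 < size T)%N by rewrite size_poly_gt0.
by move: s1u; case: (size T) => // n; case: (size _) => // [[]] // m; rewrite addnS.
Qed.

(** Multiply a monic equation of v of degree s by x^s: it becomes g^s plus lower terms, each
    divisible by x. *)
Lemma integral_divides x v g : integralOver f v -> f x * v = f g ->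
  exists s y, f (x * y) = f g ^+ s.
Proof.
move=> [Q monQ /rootP rQ] e; have [s sQ] : exists s, size Q = s.+1.
  by exists (size Q).-1; rewrite prednK // size_poly_gt0 monic_neq0.
exists s, (- \sum_(i < s) Q`_i * g ^+ i * x ^+ (s - i).-1).
have Qs : Q`_s = 1 by move: (monicP monQ); rewrite lead_coefE sQ.
move: rQ; rewrite (@horner_coef_wide _ s.+1) -?sQ ?size_poly // sQ.
rewrite big_ord_recr /= coef_map /= Qs rmorph1 mul1r => rQ.
have {}rQ : v ^+ s = - \sum_(i < s) (map_poly f Q)`_i * v ^+ i.
  by apply/eqP; rewrite -addr_eq0 addrC rQ.
rewrite -e exprMn rQ 2!mulrN rmorphN; congr (- _).
rewrite !mulr_sumr rmorph_sum; apply: eq_bigr => i _ /=.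
rewrite !rmorphM !rmorphXn -e coef_map /=.
have -> : f x ^+ s =
    f x * f x ^+ (s - i).-1 * f x ^+ i.
  by rewrite -exprS -exprD prednK ?subn_gt0 // subnK // ltnW.
rewrite exprMn; ring.
Qed.

(** Cancel powers of w from an equation of w until its constant term is nonzero; that constant is
    then a multiple of w. *)
Lemma nonzero_multiple (w : K) Q : w != 0 -> map_poly f Q != 0 ->
  root (map_poly f Q) w -> exists d V, f d != 0 /\ f d = w * (map_poly f V).[w].
Proof.
move=> w0; elim/poly_ind: Q => [|Q c IH]; first by rewrite rmorph0 eqxx.
rewrite rmorphD rmorphM /= map_polyX map_polyC /= => Q0 /rootP.
rewrite hornerD hornerM hornerX hornerC => e.
case: (eqVneq (f c) 0) => [c0|c0]; last first.
  exists (- c), Q; rewrite rmorphN oppr_eq0; split=> //.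
  by rewrite mulrC -[RHS]addr0 -(subrr (f c)) addrA e add0r.
apply: IH; first by apply: contraNneq Q0 => ->; rewrite c0 mul0r add0r.
by move: e; rewrite c0 addr0 => /eqP; rewrite mulf_eq0 (negPf w0) orbF.
Qed.

(** Let F witness the property for R[a] and c be the leading coefficient of p. Some nonzero d in R
    is a multiple of F in R[a], so each nonzero x in R divides a power of d there. A power of c
    makes the cofactor integral over R, and [integral_divides] brings the divisibility down to R.
    Hence c d is a witness for R. *)
Lemma goldman_descent p : map_poly f p != 0 -> root (map_poly f p) a ->
  goldman adjunction -> goldman f.
Proof.
set q := map_poly f p => q0 rq [F /= F0 hF].
have sq : (1 < size q)%N.
  rewrite ltnNge; apply/negP => /size1_polyC eq; move: rq q0.
  by rewrite eq rootC polyC_eq0 => ->.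
pose m := (size q).-2; have em : size q = m.+2 by rewrite /m; case: (size q) sq => [|[]].
pose cR := p`_m.+1; have ec : f cR = lead_coef q.
  by rewrite /cR -coef_map lead_coefE em.
have c0 : f cR != 0 by rewrite ec lead_coef_eq0.
have intca : integralOver f (f cR * a).
  (* Multiplying the equation of a by c^m, where c is its leading coefficient, makes it monic in c
     a. *)
  pose Q := 'X^(m.+1) + \poly_(i < m.+1) (f cR ^+ (m - i) * q`_i).
  have sP : (size (\poly_(i < m.+1) (f cR ^+ (m - i) * q`_i))%R <
      size ('X^(m.+1) : {poly K})%R)%N.
    by rewrite size_polyXn ltnS size_poly.
  apply: (@integral_root_monic _ _ _ _ Q).
  - by rewrite monicE lead_coefDl // lead_coefXn.
  - apply/rootP; rewrite hornerD hornerXn horner_poly.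
    have := rq; move/rootP; rewrite horner_coef em big_ord_recr /=.
    rewrite -[q`_m.+1]/(q`_(m.+2.-1)) -em -lead_coefE -ec => /(congr1 ( *%R (f cR ^+ m))).
    rewrite mulr0 mulrDr => e0; rewrite -[RHS]e0 addrC; congr (_ + _); last first.
      by rewrite exprMn exprSr mulrA.
    rewrite mulr_sumr; apply: eq_bigr => i _.
    have -> : f cR ^+ m = f cR ^+ (m - i) * f cR ^+ i.
      by rewrite -exprD subnK // -ltnS.
    by rewrite exprMn; ring.
  - apply/integral_poly => i; rewrite coefD coefXn coef_poly.
    apply: integral_add; first exact: integral_nat.
    case: ifP => _; last exact: integral0.
    by rewrite coef_map -rmorphXn -rmorphM; apply: integral_id.
(* Every element of R[a] becomes integral over R after multiplication by a power of c. *)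
have int (Z : {poly R}) : integralOver f (f cR ^+ size Z * adjunction Z).
  rewrite adjunctionE (horner_coef_wide _ (size_poly _ _)) mulr_sumr.
  apply: (big_ind (integralOver f)); [exact: integral0|exact: integral_add|].
  move=> i _; have -> : f cR ^+ size Z * ((map_poly f Z)`_i * a ^+ i) =
    f (Z`_i * cR ^+ (size Z - i)) * (f cR * a) ^+ i.
    have -> : f cR ^+ size Z = f cR ^+ (size Z - i) * f cR ^+ i.
      by rewrite -exprD subnK // ltnW.
    by rewrite exprMn coef_map rmorphM rmorphXn /=; ring.
  apply: integral_mul; first exact: integral_id.
  elim: (i : nat) => [|j IHj]; first exact: integral1.
  by rewrite exprS; apply: integral_mul.
pose W := cR%:P ^+ size F * F.
have eW : adjunction W = f cR ^+ size F * adjunction F.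
  by rewrite rmorphM rmorphXn /= adjunctionC.
have W0 : adjunction W != 0 by rewrite eW mulf_neq0 ?expf_neq0.
have [Q monQ rQ] := int F; rewrite -eW in rQ.
have Q0 : map_poly f Q != 0 by rewrite monic_neq0 ?monic_map.
have [d [V [d0 ed]]] := nonzero_multiple W0 Q0 rQ.
have {V}[B {}ed] : exists B, f d = adjunction F * adjunction B.
  exists (cR%:P ^+ size F * (map_poly polyC V).[W]).
  rewrite ed adjunction_horner eW [in RHS]rmorphM rmorphXn /= adjunctionC; ring.
exists (cR * d); first by rewrite rmorphM mulf_neq0.
move=> x x0; have [|N [Y eY]] := hF x%:P; first by rewrite adjunctionC.
have {eY Y}[Y eY] : exists Y, f x * adjunction Y = f d ^+ N.
  exists (Y * B ^+ N); rewrite ed exprMn -eY -[f x](adjunctionC x).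
  by rewrite -rmorphXn -!rmorphM mulrA.
pose e := size Y; have [] := integral_divides (x := x) (g := cR ^+ e * d ^+ N) (int Y).
  by rewrite mulrCA eY rmorphM !rmorphXn.
move=> s [y exy]; exists ((e + N) * s)%N, (y * (cR ^+ N * d ^+ e) ^+ s).
rewrite mulrA rmorphM exy -rmorphXn -rmorphM -rmorphXn /=; congr (f _).
by rewrite -exprMn exprM; congr (_ ^+ _); rewrite !exprMn !exprD; ring.
Qed.

End Adjunction.

(** K is generated by [s] as an algebra over the image of [f]; formulated by subrings so that a
    generator is easily moved into the base ring. *)
Definition generated_by (R : comNzRingType) (f : {rmorphism R -> K}) (s : seq K) :=
  forall D : K -> Prop, (forall x y, D x -> D y -> D (x - y)) ->
    (forall x y, D x -> D y -> D (x * y)) -> (forall r, D (f r)) ->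
    (forall a, a \in s -> D a) -> forall z, D z.

Hypothesis K_field : forall z : K, z != 0 -> exists z', z * z' = 1.

(** Move one generator a into the base. By induction R[a] is Goldman, so a is algebraic and the
    property descends to R. Without generators, f is onto the field K. *)
Lemma goldman_generated (R : comNzRingType) (f : {rmorphism R -> K}) s :
  generated_by f s -> goldman f.
Proof.
elim: s R f => [|a s IH] R f gen.
  have surj z : exists r, z = f r.
    apply: (gen (fun z => exists r, z = f r)) => //=
      [_ _ [x ->] [y ->]|_ _ [x ->] [y ->]|r].
    - by exists (x - y); rewrite rmorphB.
    - by exists (x * y); rewrite rmorphM.
    - by exists r.
  exists 1; first by rewrite rmorph1 oner_eq0.
  move=> x /K_field[z e]; have [y ez] := surj z; exists 0%N, y.
  by rewrite rmorphM -ez.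
have G : goldman (adjunction f a).
  apply: IH => D DB DM Df Da; apply: gen => // [r|b].
    by rewrite -(adjunctionC f a); apply: Df.
  rewrite inE => /predU1P[->|]; last exact: Da.
  by rewrite -[a]hornerX -(map_polyX f) -adjunctionE; apply: Df.
have [p p0 rp] := goldman_algebraic G.
exact: goldman_descent p0 rp G.
Qed.

(** The generators [s] also generate K over k[a], which is therefore Goldman; this forces a to be
    algebraic. *)
Lemma zariski (k : fieldType) (f : {rmorphism k -> K}) s a :
  generated_by f s -> exists2 p : {poly k}, p != 0 & (map_poly f p).[a] = 0.
Proof.
move=> gen; have [|p p0 /rootP rp] := @goldman_algebraic _ f a.
  apply: (@goldman_generated _ _ s) => D DB DM Df Da; apply: gen => // r.
  by rewrite -(adjunctionC f a); apply: Df.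
by exists p => //; apply: contraNneq p0 => ->; rewrite rmorph0.
Qed.

End Goldman.

(** * Polynomials in one of the variables *)

Section UnivariateElements.
Variables (k : fieldType) (n : nat).
Local Notation S := {mpoly k[n]}.

Definition univ (j : 'I_n) (f : {poly k}) : S := (map_poly (@mpolyC n k) f).['X_j].

Lemma univX j : univ j 'X = 'X_j.
Proof. by rewrite /univ map_polyX hornerX. Qed.

Section Separate.
Variable j : 'I_n.

(** Expansion in powers of x_j. The coefficients do not involve x_j but stay in [S], which avoids a
    second polynomial ring. *)
Definition separate : S -> {poly S} :=
  mmap (polyC \o @mpolyC n k) (fun i => if i == j then 'X else ('X_i)%:P).
HB.instance Definition _ := GRing.RMorphism.on separate.

Lemma separateC c : separate c%:MP = (c%:MP)%:P.
Proof. by rewrite /separate mmapC. Qed.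

Lemma separateX i : separate 'X_i = if i == j then 'X else ('X_i)%:P.
Proof. by rewrite /separate mmapX mmap1U. Qed.

Lemma separateK p : (separate p).['X_j] = p.
Proof.
rewrite {2}[p]mpolyE /separate /mmap horner_sum; apply: eq_bigr => m _.
rewrite hornerM /= hornerC mul_mpolyC [in RHS]mpolyXE_id /mmap1 horner_prod.
congr (_ *: _); apply: eq_bigr => i _; rewrite horner_exp.
by case: eqP => [->|_]; rewrite ?hornerX ?hornerC.
Qed.

Lemma separate_univ i f : separate (univ i f) =
  if i == j then map_poly (@mpolyC n k) f else (univ i f)%:P.
Proof.
have e : map_poly separate (map_poly (@mpolyC n k) f) =
   map_poly polyC (map_poly (@mpolyC n k) f).
  rewrite -!map_poly_comp; apply: eq_map_poly => c /=; exact: separateC.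
rewrite /univ -horner_map /= e separateX; case: eqP => _; last by rewrite horner_map.
exact: comp_polyXr.
Qed.

Variables (f : 'I_n -> {poly k}) (C : {set 'I_n}).
Hypothesis jC : j \notin C.
Let J := span_elts (fun i => univ i (f i)) C.

(** The generators of [J] do not involve x_j, so membership can be tested on each coefficient in
    x_j. *)
Lemma span_univ_separate p : J p <-> forall i, J (separate p)`_i.
Proof.
split=> [[q ->] i|h].
  exists (fun c => (separate (q c))`_i); rewrite rmorph_sum coef_sum.
  apply: eq_bigr => c cC; rewrite rmorphM /= separate_univ.
  by case: eqP cC jC => [-> ->//|_ _ _]; rewrite coefMC.
rewrite -(separateK p) horner_coef; have iJ := span_elts_ideal (fun i => univ i (f i)) C.
by apply: ideal_sum => // i _; apply: ideal_mulr.
Qed.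

(** The leading coefficient of f_j is a unit, so the coefficients of p in x_j are seen to lie in [J]
    from the highest one down. *)
Lemma univ_regular p : f j != 0 -> J (univ j (f j) * p) -> J p.
Proof.
have iJ : is_ideal J by apply: span_elts_ideal.
move=> fj; have sf : (0 < size (f j))%N by rewrite size_poly_gt0.
move=> /span_univ_separate; rewrite rmorphM /= separate_univ eqxx.
set g := map_poly _ _; set h := separate p => Jgh.
suff top N i : (size h - i <= N)%N -> J h`_i.
  by apply/span_univ_separate => i; apply: top (leqnn _).
elim: N i => [|N IH] i.
  by rewrite leqn0 subn_eq0 => /(nth_default 0)->; apply: ideal_zero.
(* The product's coefficient in degree deg f_j + i is the leading coefficient of f_j times h_i, plus
   terms with higher coefficients of h, which are in [J] by induction. *)
move=> le_i; have := Jgh ((size (f j)).-1 + i)%N; rewrite coefM.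
have lt_D : ((size (f j)).-1 < ((size (f j)).-1 + i).+1)%N by rewrite ltnS leq_addr.
rewrite (bigD1 (Ordinal lt_D)) //= addKn coef_map /= -lead_coefE => Jsum.
have Jl : J ((lead_coef (f j))%:MP * h`_i).
  rewrite -[X in J X](addrK (\sum_(i0 < ((size (f j)).-1 + i).+1
    | i0 != Ordinal lt_D) g`_i0 * h`_((size (f j)).-1 + i - i0))).
  apply: ideal_sub => //; apply: ideal_sum => // a; rewrite -val_eqE /= => neq.
  have [lt_a|] := ltnP a (size (f j)).-1; last first.
    rewrite leq_eqVlt eq_sym (negPf neq) /= => lt_a; rewrite coef_map /= nth_default.
      by rewrite mpolyC0 mul0r; apply: ideal_zero.
    by apply: leq_trans lt_a; rewrite (prednK sf).
  apply: ideal_mull => //; apply: IH.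
  apply: (@leq_trans (size h - i.+1)); last by rewrite subnS -subn1 leq_subLR.
  rewrite leq_sub2l // ltn_subRL ltn_add2r //.
have := ideal_mull ((lead_coef (f j))^-1%:MP) iJ Jl.
by rewrite mulrA -mpolyCM mulVf ?lead_coef_eq0 // mpolyC1 mul1r.
Qed.

End Separate.
End UnivariateElements.

(** * Squarefree monomial ideals with the exchange property *)

Section CoverIdeals.
Variables (k : fieldType) (n : nat).
Local Notation S := {mpoly k[n]}.
Implicit Types (F : {set {set 'I_n}}) (B : {set 'I_n}) (m : 'X_{1..n}).

Definition meets B m := [exists j in B, m j != 0%N].

(** The intersection of the monomial primes (x_j | j in B), B in F; the whole ring if F is empty. *)
Definition cover_ideal F : S -> Prop :=
  fun p => forall m, m \in msupp p -> forall B, B \in F -> meets B m.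

Lemma meetsDl B m1 m2 : meets B m1 -> meets B (m1 + m2)%MM.
Proof.
move=> /existsP[j /andP[jB mj]]; apply/existsP; exists j.
by rewrite jB mnmDE addn_eq0 negb_and mj.
Qed.

Lemma cover_idealP F : is_ideal (cover_ideal F).
Proof.
split=> [m|p q hp hq m /msuppD_le|a p hp m /msuppM_le].
- by rewrite msupp0.
- by rewrite mem_cat => /orP[/hp|/hq].
- move=> /allpairsP[[m1 m2] /= [_ /hp h ->]] B BF.
  by rewrite addmC; apply/meetsDl/h.
Qed.

Lemma cover_idealX F m : cover_ideal F 'X_[m] <-> forall B, B \in F -> meets B m.
Proof.
split=> [h|h m']; first by apply: h; rewrite msuppX inE.
by rewrite msuppX inE => /eqP->.
Qed.

Lemma ideal_of_monomials (J : S -> Prop) p : is_ideal J ->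
  (forall m, m \in msupp p -> J 'X_[m]) -> J p.
Proof.
move=> iJ h; rewrite [p]mpolyE big_seq_cond; apply: ideal_sum => // m /andP[mp _].
by rewrite -mul_mpolyC; apply: ideal_mull => //; apply: h.
Qed.

Lemma mpolyX_factor m j : m j != 0%N -> 'X_[m] = 'X_[m - U_(j)] * 'X_j :> S.
Proof. by rewrite -lep1mP => h; rewrite -mpolyXD submK. Qed.

Lemma cover_ideal_sub F (J : S -> Prop) : is_ideal J ->
  (forall m, (forall B, B \in F -> meets B m) -> J 'X_[m]) ->
  forall p, cover_ideal F p -> J p.
Proof. by move=> iJ h p cp; apply: ideal_of_monomials => // m /cp/h. Qed.

Lemma cover_ideal1 B (y : 'I_n -> S) : (forall j, j \in B -> y j = 'X_j) ->
  cover_ideal [set B] = span_elts y B.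
Proof.
move=> yB; have iB := span_elts_ideal y B; apply: pred_ext => p; split.
  apply: cover_ideal_sub => // m /(_ _ (set11 _)) /existsP[j /andP[jB mj]].
  by rewrite (mpolyX_factor mj) -yB //; apply: ideal_mull => //; apply: span_elts_mem.
move=> [q ->]; apply: ideal_sum (cover_idealP _) _ => j jB.
apply: ideal_mull (cover_idealP _) _; rewrite yB //; apply/cover_idealX => _ /set1P->.
by apply/existsP; exists j; rewrite jB mnm1E eqxx.
Qed.

(** Multiplication by x_j makes a monomial meet exactly the sets containing j in addition, so these
    conditions drop out. *)
Lemma cover_ideal_colon F j :
  colon (cover_ideal F) 'X_j = cover_ideal [set B in F | j \notin B].
Proof.
have msX (p : S) m : m \in msupp p -> (m + U_(j))%MM \in msupp ('X_j * p).
  by rewrite !mcoeff_msupp mulrC addmC mcoeffMX.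
apply: pred_ext => p; split=> h.
  move=> m /msX/h mB B; rewrite inE => /andP[/mB /existsP[i /andP[iB]]].
  rewrite mnmDE mnm1E => mi jB; apply/existsP; exists i; rewrite iB /=.
  by case: (eqVneq j i) jB mi => [->|_ _]; rewrite ?iB // addn0.
move=> m /msuppM_le /allpairsP[[m1 m2] /= []]; rewrite msuppX inE => /eqP-> pm -> B BF.
have [jB|jB] := boolP (j \in B).
  by apply/meetsDl/existsP; exists j; rewrite jB mnm1E eqxx.
by rewrite addmC; apply/meetsDl/h => //; rewrite inE BF.
Qed.

(** Basis exchange for matroids in the dual form: the element j is prescribed to enter B2. *)
Definition exchange F := forall B1 B2 j, B1 \in F -> B2 \in F ->
  j \in B1 -> j \notin B2 -> exists b, [/\ b \in B2, b \notin B1 & j |: (B2 :\ b) \in F].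

(** Let a monomial free of x_j meet every member containing j. For a member B without j, it meets
    the exchanged set made of j and part of B, hence meets B itself. So I + (x_j) is again a cover
    ideal. *)
Lemma cover_ideal_add F j B1 : exchange F -> B1 \in F -> j \in B1 ->
  add_elt (cover_ideal F) 'X_j = cover_ideal [set B in F | j \in B].
Proof.
move=> exF B1F jB1; have iF := cover_idealP F; apply: pred_ext => p; split.
  move=> [q hq]; apply: (@ideal_subl _ _ _ ('X_j * q)) (cover_idealP _) _ _.
    by move=> m /hq h B; rewrite inE => /andP[/h].
  apply: ideal_mulr (cover_idealP _) _; apply/cover_idealX => B.
  rewrite inE => /andP[_ jB].
  by apply/existsP; exists j; rewrite jB mnm1E eqxx.
apply: cover_ideal_sub (add_elt_ideal _ iF) _ _ => m mB.
have [mj|/negPn/eqP mj] := boolP (m j != 0%N).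
  by rewrite (mpolyX_factor mj) mulrC; apply: add_elt_in.
apply/add_elt_sub/cover_idealX => B BF.
have [jB|jB] := boolP (j \in B); first by apply: mB; rewrite inE BF.
have [b [bB _ B'F]] := exF _ _ _ B1F BF jB1 jB.
have := mB (j |: B :\ b); rewrite inE B'F setU11 => /(_ isT) /existsP[i].
rewrite !inE => /andP[/predU1P[->|/andP[_ iB]] mi]; first by rewrite mj in mi.
by apply/existsP; exists i; rewrite iB.
Qed.

(** Induction on the size of F: an index j in some but not all members splits F into two smaller
    families, belonging to I : x_j and I + (x_j). A single member is the case of
    [weakly_regular_elem_syms]. *)
Lemma weakly_regular_cover_ideal F (y : 'I_n -> S) d :
  (forall (C : {set 'I_n}) j x, j \notin C ->
    span_elts y C (y j * x) -> span_elts y C x) ->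
  F != set0 -> (forall B, B \in F -> (#|B| + d)%N = n) ->
  (forall B j, B \in F -> j \in B -> y j = 'X_j) -> exchange F ->
  weakly_regular (cover_ideal F) (elem_syms y d).
Proof.
move=> regy; elim: {F}#|F| {-2}F (leqnn #|F|) => [|N IH] F.
  by rewrite leqn0 cards_eq0 => /eqP->; rewrite eqxx.
move=> cF F0 dF yF exF; have /set0Pn[B0 B0F] := F0.
have [F1|] := eqVneq F [set B0].
  rewrite F1 (@cover_ideal1 _ y); last by move=> j; apply: yF.
  by apply: weakly_regular_elem_syms => //; apply: dF.
move=> nF1; have [B1 B1F nB] : exists2 B1, B1 \in F & B1 != B0.
  apply: contrapT => h; case/eqP: nF1; apply/setP => B; rewrite inE.
  apply/idP/eqP => [BF|->//]; apply: contrapT => /eqP nB; apply: h.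
  by exists B.
have [j jB1 jB0] : exists2 j, j \in B1 & j \notin B0.
  apply/subsetPn; apply: contraNN nB => sB; rewrite eqEcard sB.
  by rewrite /= -(leq_add2r d) !dF.
have sub (P : pred {set 'I_n}) B : B \in F -> P B -> forall B', B' \in F -> ~~ P B' ->
    exchange [set B in F | P B] ->
    weakly_regular (cover_ideal [set B in F | P B]) (elem_syms y d).
  move=> BF PB B' B'F nPB' exP; apply: IH => //.
  - rewrite -ltnS; apply: leq_trans cF; apply: proper_card.
    apply/properP; split; first by apply/subsetP => C; rewrite inE => /andP[].
    by exists B' => //; rewrite inE B'F (negPf nPB').
  - by apply/set0Pn; exists B; rewrite inE BF.
  - by move=> C; rewrite inE => /andP[/dF].
  - by move=> C i; rewrite inE => /andP[CF _]; apply: yF.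
(* Both halves keep the exchange property: the entering element lies in C1 and the leaving one does
   not, so membership of j is unchanged. *)
apply: (@weakly_regular_colon _ _ 'X_j _ (cover_idealP F)).
  rewrite cover_ideal_colon; apply: (sub _ B0 _ _ B1) => //; first by rewrite negbK.
  move=> C1 C2 i; rewrite !inE => /andP[C1F jC1] /andP[C2F jC2] iC1 iC2.
  have [b [bC2 bC1 C'F]] := exF _ _ _ C1F C2F iC1 iC2.
  exists b; split=> //; rewrite !inE C'F negb_or (negPf jC2) andbF andbT.
  by apply: contraNneq jC1 => ->.
rewrite (cover_ideal_add exF B1F jB1); apply: (sub _ B1 _ _ B0) => //.
move=> C1 C2 i; rewrite !inE => /andP[C1F jC1] /andP[C2F jC2] iC1 iC2.
have [b [bC2 bC1 C'F]] := exF _ _ _ C1F C2F iC1 iC2.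
exists b; split=> //; rewrite !inE C'F jC2 andbT.
by apply/orP; right; apply: contraNneq bC1 => <-.
Qed.

End CoverIdeals.

(** * Localization at a maximal ideal *)

Section Transfer.
Variables (A Q : comNzRingType) (iota : {rmorphism A -> Q}) (T : A -> Prop).
Hypothesis T_one : T 1.
Hypothesis T_mul : forall t u, T t -> T u -> T (t * u).
Hypothesis T_unit : forall t, T t -> exists v, v * iota t = 1.
Hypothesis frac : forall q, exists t p, T t /\ iota t * q = iota p.

(* JQ is the extension of J to the ring of fractions Q = T^-1 (A / ker iota). *)
Definition extension (J : A -> Prop) (JQ : Q -> Prop) :=
  [/\ is_ideal J, is_ideal JQ & forall p, JQ (iota p) <-> exists2 t, T t & J (t * p)].

Lemma extension_add_elt J JQ a : extension J JQ ->
  extension (add_elt J a) (add_elt JQ (iota a)).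
Proof.
move=> [iJ iQ e]; split; [exact: add_elt_ideal|exact: add_elt_ideal|].
move=> p; split=> [[q Jq]|[t Tt [y Jy]]].
  have [t [p' [Tt ep]]] := frac q.
  have /e[u Tu Ju] : JQ (iota (t * p - a * p')).
    rewrite rmorphB !rmorphM -ep.
    have -> : iota t * iota p - iota a * (iota t * q) =
      iota t * (iota p - iota a * q) by ring.
    exact: ideal_mull.
  exists (u * t); first exact: T_mul.
  exists (u * p'); have -> : u * t * p - a * (u * p') = u * (t * p - a * p') by ring.
  done.
have [v ev] := T_unit Tt; exists (v * iota y).
have -> : iota p - iota a * (v * iota y) = v * iota (t * p - a * y).
  by rewrite rmorphB !rmorphM mulrBr [v * (iota t * _)]mulrA ev mul1r; ring.
by apply: ideal_mull => //; apply/e; exists 1; rewrite ?mul1r.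
Qed.

Lemma extension_add_elts J JQ g : extension J JQ ->
  extension (add_elts J g) (add_elts JQ (map iota g)).
Proof. by elim: g J JQ => //= a g IH J JQ /(extension_add_elt a)/IH. Qed.

(** Clearing denominators carries a relation a q in JQ back to J, up to a factor from T. *)
Lemma extension_weakly_regular J JQ g : extension J JQ ->
  weakly_regular J g -> weakly_regular JQ (map iota g).
Proof.
elim: g J JQ => //= a g IH J JQ ext [rega /IH wg]; split; last first.
  by apply: wg; apply: extension_add_elt.
have [iJ iQ e] := ext => q; have [t [p [Tt ep]]] := frac q => Jaq.
have /e[u Tu] : JQ (iota (a * p)).
  by rewrite rmorphM -ep mulrCA; apply: ideal_mull.
rewrite mulrCA => /rega Jup; have [v ev] := T_unit Tt.
have -> : q = v * iota p by rewrite -ep mulrA ev mul1r.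
by apply: ideal_mull => //; apply/e; exists u.
Qed.

End Transfer.

Section LocalizedQuotient.
Variables (R : comNzRingType) (P : prime_idealr R).

Definition to_loc (a : R) : localization P := mkfrac a (denom1 P).

Lemma to_loc_additive : additive to_loc.
Proof.
move=> x y; rewrite -[RHS]/(loc_add (to_loc x) (loc_opp (to_loc y))).
rewrite /to_loc loc_oppE loc_addE.
by apply: mkfrac_eq => /=; ring.
Qed.
HB.instance Definition _ := GRing.isZmodMorphism.Build R (localization P)
  to_loc to_loc_additive.

Lemma to_loc_monoid_morphism : monoid_morphism to_loc.
Proof.
split=> // x y; rewrite -[RHS]/(loc_mul (to_loc x) (to_loc y)) loc_mulE.
by apply: mkfrac_eq => /=; ring.
Qed.
HB.instance Definition _ := GRing.isMonoidMorphism.Build R (localization P)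
  to_loc to_loc_monoid_morphism.

Lemma to_loc_unit t : t \notin P -> exists v, v * to_loc t = 1.
Proof.
move=> tP; exists (mkfrac 1 (exist _ t tP)); rewrite /to_loc [_ * _]loc_mulE.
by apply: mkfrac_eq => /=; ring.
Qed.

Lemma to_loc_frac (q : localization P) :
  exists t p, t \notin P /\ to_loc t * q = to_loc p.
Proof.
have [a [s ->]] := mkfrac_surj q; exists (val s), a; split; first exact: (valP s).
by rewrite [_ * _]loc_mulE; apply: mkfrac_eq => /=; ring.
Qed.

Lemma to_loc_eq0 p : to_loc p = 0 <-> exists2 t, t \notin P & t * p = 0.
Proof.
split=> [/mkfracP[u uP]|[u uP e]].
  by rewrite /= mul0r subr0 mulr1 => e; exists u.
by apply/mkfracP; exists u; rewrite //= mul0r subr0 mulr1.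
Qed.

End LocalizedQuotient.

(** * Regular sequences in the localized quotient *)

Section RegularSequence.
Variables (A : comNzRingType) (I : idealr A) (P : prime_idealr {ideal_quot I}).
Local Notation R := {ideal_quot I}.
Let outside (s : A) : Prop := \pi_R s \notin P.
Let iota : {rmorphism A -> localization P} := to_loc P \o \pi_R.

(** J may be larger than I, but u J lies in I with u outside P, so both have the same localization:
    J extends to zero in (A/I)_P. *)
Lemma quot_loc_regular_seq (J : A -> Prop) u g :
  is_ideal J -> (forall x, x \in I -> J x) -> outside u ->
  (forall x, J x -> u * x \in I) -> weakly_regular J g ->
  (forall a, a \in g -> \pi_R a \in P) ->
  regular_seq (map iota g) /\ (forall x, x \in map iota g -> nonunit x).
Proof.
move=> iJ IJ uP uJ wg gP.
have pi0 x : (x \in I) = (\pi_R x == 0).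
  by rewrite -[0](rmorph0 \pi_R) -Quotient.idealrBE subr0.
have T1 : outside 1 by rewrite /outside rmorph1 idealr1.
have TM t v : outside t -> outside v -> outside (t * v).
  by rewrite /outside rmorphM prime_idealrM negb_or => -> ->.
have TU t : outside t -> exists v, v * iota t = 1 by apply: to_loc_unit.
have Tfrac q : exists t p, outside t /\ iota t * q = iota p.
  have [t [p [tP e]]] := to_loc_frac q; exists (repr t), (repr p).
  by rewrite /outside /iota /= !reprK.
have JP x : J x -> \pi_R x \in P.
  move=> /uJ; rewrite pi0 rmorphM => /eqP e; have : \pi_R u * \pi_R x \in P.
    by rewrite e idealr0.
  by rewrite prime_idealrM (negPf uP).
have ext : extension iota outside J (fun x => x = 0).
  split=> [//||p]; first exact: zero_ideal.
  rewrite /iota /=; split=> [/to_loc_eq0[t tP e]|[t tP Jt]].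
    exists (repr t); rewrite /outside ?reprK //; apply: IJ.
    by rewrite pi0 rmorphM /= reprK e.
  apply/to_loc_eq0; exists (\pi_R (u * t)); first exact: TM.
  by apply/eqP; rewrite -rmorphM -pi0 -mulrA uJ.
have gP' : forall x, add_elts J g x -> \pi_R x \in P.
  elim: g J {iJ IJ uJ wg ext} JP gP => //= a g IH J JP gP; apply: IH.
    move=> x [y /JP]; rewrite rmorphB rmorphM => h.
    rewrite -(subrK (\pi_R a * \pi_R y) (\pi_R x)) rpredD // mulrC idealMr //.
    by apply: gP; rewrite mem_head.
  by move=> b bg; apply: gP; rewrite inE bg orbT.
split.
  apply/regular_seqE; split; first exact: extension_weakly_regular ext wg.
  have [_ _ e] := extension_add_elts T1 TM TU Tfrac g ext.
  by rewrite -(rmorph1 iota) => /e[t tP]; rewrite mulr1 => /gP'; apply/negP.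
move=> _ /mapP[a /gP aP ->] [y ey]; have [t [p [tP etp]]] := Tfrac y.
have [_ _ /(_ (p * a - t))[h _]] := ext.
have /h[v vP /JP] : iota (p * a - t) = 0.
  by rewrite rmorphB rmorphM -etp -mulrA ey mulr1 subrr.
rewrite rmorphM prime_idealrM (negPf vP) /= rmorphB rmorphM => h2.
case/negP: tP; rewrite -(subKr (\pi_R p * \pi_R a) (\pi_R t)).
by rewrite rpredB // idealMr.
Qed.

End RegularSequence.

(** One sequence settles both invariants: it gives a chain of its own length, and a longer regular
    sequence would give a chain exceeding the bound. *)
Lemma local_cohen_macaulay_of (Q : comNzRingType) (s : seq Q) :
  regular_seq s -> (forall x, x \in s -> nonunit x) ->
  (forall n (P : nat -> prime_idealr Q), prime_chain n P -> (n <= size s)%N) ->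
  local_cohen_macaulay Q.
Proof.
move=> rs ns bound; exists (size s); split; split=> //.
- exact: regular_seq_prime_chain.
- by exists s.
- by move=> s' /regular_seq_prime_chain[P /bound].
Qed.

(** * Residue fields of maximal ideals *)

Section Residue.

(** Otherwise P + (x) would be proper, hence an [idealr] strictly above P. *)
Lemma maximal_ideal_inv (R : comNzRingType) (P : prime_idealr R) x :
  maximal_ideal P -> x \notin P -> exists y, 1 - x * y \in P.
Proof.
move=> maxP xP; apply: contrapT => nx.
have iP : is_ideal (fun z => z \in P : Prop) by have [] := prime_idealr_is_prime P.
pose S : {pred R} := fun z => `[< add_elt (fun z => z \in P : Prop) x z >].
have S_in z : (z \in S) = `[< add_elt (fun z => z \in P : Prop) x z >] by [].
have iS := add_elt_ideal x iP.
have Sc : idealr_closed S.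
  split; rewrite ?S_in.
  - by apply/asboolP; apply: ideal_zero.
  - by apply/asboolP => -[y hy]; apply: nx; exists y.
  - move=> a u v; rewrite !S_in => /asboolP Ju /asboolP Jv; apply/asboolP.
    by apply: ideal_add => //; apply: ideal_mull.
pose J : idealr R := HB.pack S (isIdealr.Build R S Sc).
have PJ : {subset P <= J} by move=> z zP; apply/asboolP; apply: add_elt_sub.
case/negP: xP; apply: (maxP J PJ); apply/asboolP; exists 1.
by rewrite mulr1 subrr idealr0.
Qed.

Lemma fieldType_of_inverses (R : comNzRingType) :
  (forall x : R, x != 0 -> exists y, y * x = 1) ->
  exists (K : fieldType) (g : {rmorphism R -> K}),
    injective g /\ forall z, exists x, z = g x.
Proof.
(* The field structure requires 0 as the inverse of 0. *)
move=> inv; have /choice[v hv] x :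
    exists y : R, (x != 0 -> y * x = 1) /\ (x = 0 -> y = 0).
  case: (eqVneq x 0) => [->|x0]; first by exists 0.
  by have [y ey] := inv x x0; exists y; split=> // e; rewrite e eqxx in x0.
pose K : fieldType := HB.pack (GRing.ComNzRing.sort R)
  (GRing.ComNzRing_isField.Build R (fun x => (hv x).1) ((hv 0).2 erefl)).
exists K, (idfun : {rmorphism R -> R}); split=> // z; by exists z.
Qed.

(** K is generated over k by the images of the variables, so Zariski's lemma makes the image of x_j
    algebraic. *)
Lemma univ_vanish (k : fieldType) n (K : fieldType)
    (h : {rmorphism {mpoly k[n]} -> K}) j :
  (forall z, exists p, z = h p) -> exists2 f, f != 0 & h (univ j f) = 0.
Proof.
move=> surj; pose f : {rmorphism k -> K} := h \o @mpolyC n k.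
have gen : generated_by f (codom (fun i => h 'X_i)).
  move=> D DB DM Df DX z; have [p ->] := surj z.
  have D0 : D 0 by rewrite -(rmorph0 f); apply: (Df).
  have DD x y : D x -> D y -> D (x + y).
    move=> Dx Dy; rewrite -[y]opprK; apply: (DB) => //.
    by rewrite -[- y]sub0r; apply: (DB).
  rewrite [p]mpolyE rmorph_sum; apply: (big_ind D) => // m _.
  rewrite -mul_mpolyC rmorphM; apply: (DM); first exact: Df.
  rewrite mpolyXE_id rmorph_prod; apply: (big_ind D) => // [|i _].
    by rewrite -(rmorph1 f); apply: (Df).
  rewrite rmorphXn; elim: (m i) => [|e IH].
    by rewrite expr0 -(rmorph1 f); apply: (Df).
  by rewrite exprS; apply: (DM) => //; apply: (DX); apply: codom_f.
have Kinv (z : K) : z != 0 -> exists z', z * z' = 1.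
  by move=> z0; exists z^-1; rewrite divff.
have [p p0 ep] := zariski Kinv (h 'X_j) gen; exists p => //.
by rewrite /univ -horner_map -map_poly_comp.
Qed.

Lemma univ_in_maximal (k : fieldType) n (I : idealr {mpoly k[n]})
    (P : prime_idealr {ideal_quot I}) j : maximal_ideal P ->
  exists2 f : {poly k}, f != 0 & \pi_({ideal_quot I}) (univ j f) \in P.
Proof.
move=> maxP; have piP x : (x \in P) = (\pi_({ideal_quot P}) x == 0).
  by rewrite -[0](rmorph0 \pi_({ideal_quot P})) -Quotient.idealrBE subr0.
have [|K [g [injg surjg]]] := @fieldType_of_inverses {ideal_quot P}.
  move=> x; rewrite -[x]reprK -piP => /(maximal_ideal_inv maxP)[y].
  rewrite piP rmorphB rmorph1 rmorphM => /eqP/subr0_eq e.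
  by exists (\pi_({ideal_quot P}) y); rewrite mulrC e.
pose h : {rmorphism {mpoly k[n]} -> K} :=
  g \o (\pi_({ideal_quot P}) \o \pi_({ideal_quot I})).
have [z|f f0 ef] := @univ_vanish k n K h j.
  have [x ->] := surjg z; exists (repr (repr x)); by rewrite /h /= !reprK.
exists f => //; rewrite piP; apply/eqP/injg; rewrite rmorph0; exact: ef.
Qed.

End Residue.

(** * Upper bound for chains of primes *)

Section ChainIndependence.
Variables (k : fieldType) (n : nat).
Local Notation S := {mpoly k[n]}.

Fixpoint monomial_at (a : nat -> S) (e : seq nat) : S :=
  if e is x :: e' then a 0%N ^+ x * monomial_at (a \o succn) e' else 1.

(* Elements a_i of Q_(i+1) \ Q_i are algebraically independent modulo Q_0:
   factor out the least power of a_0 and reduce modulo Q_1. *)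
Lemma chain_independent (T : eqType) (ex : T -> seq nat) (c : T -> k) m
    (Q : nat -> S -> Prop) (a : nat -> S) (E : seq T) :
  (forall i, (i <= m)%N -> is_prime (Q i)) ->
  (forall i, (i < m)%N -> [/\ forall x, Q i x -> Q i.+1 x, Q i.+1 (a i) & ~ Q i (a i)]) ->
  uniq E -> {in E &, injective ex} -> {in E, forall t, size (ex t) = m} ->
  {in E, forall t, c t != 0} ->
  Q 0%N (\sum_(t <- E) (c t)%:MP * monomial_at a (ex t)) -> E = [::].
Proof.
elim: m Q a ex E => [|m IH] Q a ex E pQ sQ uE injE sE cE QE.
  have [iQ Q1 _] := pQ 0%N isT.
  case: E uE injE sE cE QE => // t [|u E] uE injE sE cE QE; last first.
    move: uE; rewrite /= inE (injE t u) ?eqxx ?inE ?eqxx ?orbT //.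
    by rewrite (size0nil (sE t _)) ?(size0nil (sE u _)) ?inE ?eqxx ?orbT.
  case: Q1; move: QE; rewrite big_seq1 (size0nil (sE t _)) ?inE //= mulr1.
  move=> /(ideal_mull (c t)^-1%:MP iQ).
  by rewrite -mpolyCM mulVf ?mpolyC1 // cE ?inE.
have [//|/hasP[t0 t0E _]] : E = [::] \/ has predT E by case: (E); [left|right].
pose hd t := head 0%N (ex t).
have [x /hasP[t1 t1E /eqP ht1] xmin] : exists2 x, has (fun t => hd t == x) E &
    {in E, forall t, (x <= hd t)%N}.
  have ex0 : exists x, has (fun t => hd t == x) E.
    by exists (hd t0); apply/hasP; exists t0.
  case: (ex_minnP ex0) => x hx xmin; exists x => // t tE; apply: xmin.
  by apply/hasP; exists t.
have exE t : t \in E -> ex t = hd t :: behead (ex t).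
  by move=> /sE; rewrite /hd; case: (ex t).
have [iQ0 Q0_1 Q0M] := pQ 0%N isT.
have [sub01 Q1a Q0a] := sQ 0%N isT.
have [iQ1 _ _] := pQ 1%N isT.
pose rest t := (c t)%:MP * monomial_at (a \o succn) (behead (ex t)).
have Q0X e y : Q 0%N (a 0%N ^+ e * y) -> Q 0%N y.
  elim: e => [|e IHe]; first by rewrite mul1r.
  by rewrite exprS -mulrA => /Q0M[].
have Q1s : Q 1%N (\sum_(t <- E | hd t == x) rest t).
  have eqsum : \sum_(t <- E) (c t)%:MP * monomial_at a (ex t) =
      a 0%N ^+ x * \sum_(t <- E) a 0%N ^+ (hd t - x) * rest t.
    rewrite mulr_sumr big_seq [RHS]big_seq; apply: eq_bigr => t tE.
    by rewrite [RHS]mulrA -exprD subnKC ?xmin // {1}exE //= /rest; ring.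
  move: QE; rewrite eqsum => /Q0X/sub01.
  rewrite (bigID (fun t => hd t == x)) /=.
  under eq_bigr => t /eqP-> do rewrite subnn expr0 mul1r.
  move=> h; apply: (@ideal_subl _ _ _
    (- \sum_(t <- E | hd t != x) a 0%N ^+ (hd t - x) * rest t) iQ1).
    by rewrite opprK.
  apply: ideal_opp => //; rewrite big_seq_cond; apply: ideal_sum => // t /andP[tE ne].
  have -> : (hd t - x)%N = (hd t - x).-1.+1.
    by rewrite prednK // subn_gt0 ltn_neqAle eq_sym ne xmin.
  by rewrite exprS -mulrA; apply: ideal_mulr.
pose E' := [seq t <- E | hd t == x].
suff : E' = [::].
  move/eqP; rewrite -[_ == _]negbK -has_filter.
  by move=> /hasPn/(_ _ t1E); rewrite ht1 eqxx.
apply: (IH (Q \o succn) (a \o succn) (behead \o ex)).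
- by move=> i le_i; apply: pQ.
- by move=> i lt_i; apply: sQ.
- exact: filter_uniq.
- move=> t u; rewrite !mem_filter => /andP[/eqP ht tE] /andP[/eqP hu uE'] /= e.
  by apply: injE => //; rewrite exE // [RHS]exE // ht hu e.
- by move=> t; rewrite mem_filter => /andP[_ /sE] /=; rewrite size_behead => ->.
- by move=> t; rewrite mem_filter => /andP[_ /cE].
- by rewrite /E' big_filter.
Qed.
End ChainIndependence.

(** * Algebraic relations by counting monomials *)

Section AlgebraicRelation.
Variables (k : fieldType) (n : nat).
Local Notation S := {mpoly k[n]}.

Definition degree_le D (p : S) := forall mu, mu \in msupp p -> (mdeg mu <= D)%N.

Lemma degree_leM D1 D2 p q :
  degree_le D1 p -> degree_le D2 q -> degree_le (D1 + D2) (p * q).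
Proof.
move=> hp hq mu /msuppM_le /allpairsP[[m1 m2] /= [/hp h1 /hq h2 ->]].
by rewrite mdegD leq_add.
Qed.

Lemma degree_le1 D : degree_le D 1.
Proof. by move=> mu; rewrite msupp1 inE => /eqP->; rewrite mdeg0. Qed.

Lemma degree_leX D e p : degree_le D p -> degree_le (e * D) (p ^+ e).
Proof.
move=> hp; elim: e => [|e IH]; first exact: degree_le1.
by rewrite exprS mulSn; apply: degree_leM.
Qed.

Lemma degree_le_monomial_at N s (a : nat -> S) (e : seq nat) :
  all (leq^~ N) e -> (forall i, (i < size e)%N -> degree_le s (a i)) ->
  degree_le (size e * (N * s)) (monomial_at a e).
Proof.
elim: e a => [|x e IH] a /=; first by move=> _ _; apply: degree_le1.
move=> /andP[xN eN] da; rewrite mulSn; apply: degree_leM.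
  by move=> mu /(degree_leX (da 0%N isT))/leq_trans; apply; rewrite leq_mul2r xN orbT.
by apply: IH => // i lt_i; apply: (da i.+1).
Qed.

Lemma exists_degree_le m (a : nat -> S) :
  exists s, forall i, (i < m)%N -> degree_le s (a i).
Proof.
exists (\max_(i < m) msize (a i)) => i lt_i mu /msize_mdeg_lt/ltnW/leq_trans; apply.
exact: (leq_bigmax (Ordinal lt_i)).
Qed.

Lemma dependent_family (I J : finType) (M : I -> J -> k) : (#|J| < #|I|)%N ->
  exists v : I -> k, (exists i, v i != 0) /\ forall j, \sum_i v i * M i j = 0.
Proof.
move=> ltJI; pose A := \matrix_(i < #|I|, j < #|J|) M (enum_val i) (enum_val j).
have : kermx A != 0.
  by rewrite -mxrank_eq0 mxrank_ker -lt0n subn_gt0 (leq_ltn_trans (rank_leq_col A)).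
case/rowV0Pn => v /sub_kermxP vA /rV0Pn[i vi].
exists (fun i => v 0 (enum_rank i)); split.
  by exists (enum_val i); rewrite enum_valK.
move=> j; have /matrixP/(_ 0 (enum_rank j)) := vA; rewrite !mxE => e.
rewrite -[RHS]e (reindex (@enum_val I predT)) /=; last first.
  by apply: onW_bij; apply: enum_val_bij.
by apply: eq_bigr => l _; rewrite mxE !enum_valK enum_rankK.
Qed.

(* There are N^m monomials of degree < N in each of m elements, against
   O(N^d) monomials in the d variables outside B. *)
Lemma algebraic_relation (B : {set 'I_n}) d m (a : nat -> S) :
  (#|B| + d)%N = n -> (d < m)%N ->
  exists N (v : m.-tuple 'I_N -> k), (exists t, v t != 0) /\
   forall mu : 'X_{1..n}, (forall j, j \in B -> mu j = 0%N) ->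
    (\sum_t (v t)%:MP * monomial_at a (map val t))@_mu = 0.
Proof.
move=> dB lt_dm; have [s ds] := exists_degree_le m a.
(* [D] bounds the degrees of the monomials in the a_i with exponents below N. As N > (m s + 1)^d,
   N^m >= N^(d+1) exceeds (N (m s + 1))^d >= (D + 1)^d, the number of exponent vectors in [col]. *)
pose N := ((m * s).+1 ^ d).+1; pose D := (m * (N * s))%N.
pose col := [pred f : {ffun 'I_n -> 'I_D.+1} | [forall j in B, f j == ord0]].
have card_col : #|{: {f | col f}}| = (D.+1 ^ d)%N.
  have <- : #|~: B| = d by apply/eqP; rewrite -(eqn_add2l #|B|) cardsC card_ord dB.
  rewrite card_sub -[D.+1 in RHS]card_ord -(card_pffun_on ord0 (mem (~: B)) predT).
  apply: eq_card => f; rewrite !inE; apply/forall_inP/pffun_onP => [h|[h _] j jB].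
    by split=> //; apply/supportP => j; rewrite inE negbK => /h/eqP.
  by have /supportP-> := h; rewrite ?inE ?jB.
pose mono (f : {f | col f}) : 'X_{1..n} := [multinom (val f i : nat) | i < n].
have card_lt : (#|{: {f | col f}}| < #|{: m.-tuple 'I_N}|)%N.
  rewrite card_col card_tuple card_ord.
  apply: (@leq_trans (N ^ d.+1)); last by rewrite leq_pexp2l.
  apply: (@leq_ltn_trans ((N * (m * s).+1) ^ d)).
    have leD : (D.+1 <= N * (m * s).+1)%N.
      by rewrite mulnS addSn ltnS mulnCA leq_addl.
    by case: (d) => // d'; rewrite leq_exp2r.
  by rewrite expnMn expnSr ltn_mul2l expn_gt0 /= /N ltnS.
have [v [v0 hv]] := dependent_family (fun t f =>
  (monomial_at a (map val (t : m.-tuple 'I_N)))@_(mono f)) card_lt.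
exists N, v; split=> // mu muB; rewrite raddf_sum /=.
have [muD|] := boolP [forall i, (mu i <= D)%N].
  pose f : {ffun 'I_n -> 'I_D.+1} := [ffun i => inord (mu i)].
  have cf : col f.
    apply/forall_inP => j jB; rewrite ffunE muB //.
    by apply/eqP/val_inj; rewrite /= inordK.
  have := hv (Sub f cf); have -> : mono (Sub f cf) = mu.
    by apply/mnmP => i; rewrite mnmE SubK ffunE inordK // ltnS (forallP muD).
  by move=> e; rewrite -[RHS]e; apply: eq_bigr => t _; rewrite mcoeffCM.
case/forallPn => i; rewrite -ltnNge => Di; rewrite big1 // => t _.
rewrite mcoeffCM memN_msupp_eq0 ?mulr0 //; apply: contraTN Di => mut.
rewrite -leqNgt; apply: (@leq_trans (mdeg mu)).
  by rewrite mdegE (bigD1 i) //= leq_addr.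
have := degree_le_monomial_at (N := N) (s := s) (a := a) (e := map val t).
rewrite size_map size_tuple => h; apply: h => //.
by apply/allP => _ /mapP[x _ ->]; apply: ltnW (ltn_ord x).
Qed.

(** If m > d, some nontrivial combination of monomials in the a_i has only terms divisible by an x_j
    with j in B, so it lies in Q_0, against [chain_independent]. *)
Lemma chain_length (Q : nat -> S -> Prop) (B : {set 'I_n}) d m :
  (#|B| + d)%N = n -> (forall j, j \in B -> Q 0%N 'X_j) ->
  (forall i, (i <= m)%N -> is_prime (Q i)) ->
  (forall i, (i < m)%N ->
    (forall x, Q i x -> Q i.+1 x) /\ exists x, Q i.+1 x /\ ~ Q i x) ->
  (m <= d)%N.
Proof.
move=> dB QB pQ sQ; rewrite leqNgt; apply/negP => lt_dm.
have /choice[a ha] i : exists x, (i < m)%N -> Q i.+1 x /\ ~ Q i x.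
  case: (ltnP i m) => [/sQ[_ [x hx]]|_]; last by exists 0.
  by exists x.
have [N [v [[t0 vt0] hv]]] := algebraic_relation a dB lt_dm.
have [iQ _ _] := pQ 0%N isT.
suff : [seq t <- enum {: m.-tuple 'I_N} | v t != 0] = [::].
  move/eqP; rewrite -[_ == _]negbK -has_filter.
  by move=> /hasPn/(_ t0 (mem_enum _ _)); rewrite vt0.
apply: (@chain_independent _ _ _ (fun t : m.-tuple 'I_N => map val t) v m Q a) => //.
- by move=> i lt_i; have [] := sQ i lt_i; have [] := ha i lt_i; split.
- exact/filter_uniq/enum_uniq.
- by move=> t u _ _ /(inj_map val_inj)/val_inj.
- by move=> t _; rewrite size_map size_tuple.
- by move=> t; rewrite mem_filter => /andP[].
rewrite big_filter big_enum_cond /=.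
have -> : \sum_(t | v t != 0) (v t)%:MP * monomial_at a (map val t) =
    \sum_t (v t)%:MP * monomial_at a (map val t).
  rewrite [RHS](bigID (fun t => v t != 0)) /= [X in _ + X]big1 ?addr0 // => t.
  by rewrite negbK => /eqP->; rewrite mpolyC0 mul0r.
apply: ideal_of_monomials => // mu; rewrite mcoeff_msupp => mu0.
have [j jB muj] : exists2 j, j \in B & mu j != 0%N.
  apply: contrapT => h; case/eqP: mu0; apply: hv => j jB.
  by apply: contrapT => /eqP muj; apply: h; exists j.
by rewrite (mpolyX_factor k muj); apply: ideal_mull => //; apply: QB.
Qed.

End AlgebraicRelation.

(** * Modular atomic lattices *)

Section RankedLattice.
Context {disp : Order.disp_t} (L : finTBLatticeType disp).
Local Open Scope order_scope.
Implicit Types x y z a b : L.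

(** An element maximal among those above y and not above x is meet-irreducible. *)
Lemma mi_separate x y : ~~ (x <= y) -> exists2 a, a \in mi L & (y <= a) && ~~ (x <= a).
Proof.
move=> nxy; have ok : (y <= y) && ~~ (x <= y) by rewrite lexx.
case: (@arg_maxnP L y (fun a => (y <= a) && ~~ (x <= a))
  (fun a => #|[set z | z <= a]|)) => //.
move=> a /andP[ya xa] amax; exists a; last by rewrite ya.
have above f : a < f -> x <= f.
  move=> af; apply: contraT => xf.
  have /= := amax f; rewrite (le_trans ya (ltW af)) xf => /(_ isT).
  rewrite leqNgt => /negP[]; apply/proper_card/properP; split.
    by apply/subsetP => z; rewrite !inE => /le_trans; apply; apply: ltW.
  by exists f; rewrite !inE ?lexx // lt_geF.
rewrite inE; apply/andP; split; first by apply: contraNneq xa => ->; apply: lex1.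
apply/forallP => c; apply/forallP => e; apply/implyP => /eqP ace.
apply: contraNT xa; rewrite negb_or => /andP[nac nae]; rewrite ace lexI.
by rewrite !above // lt_neqAle ?nac ?nae ace ?leIl ?leIr.
Qed.

Hypothesis L_atomic : atomic L.

Lemma atom_separate x y : ~~ (y <= x) ->
  exists2 b, b \in atoms L & (b <= y) && ~~ (b <= x).
Proof.
move=> nyx; apply: contrapT => h; case/negP: nyx; have [A /subsetP sA ey] := L_atomic y.
rewrite {1}ey; apply/joinsP => b bA; apply: contraT => nbx.
case: h; exists b; first exact: sA.
by rewrite nbx andbT ey (joins_sup _ bA).
Qed.

Variable rk : L -> int.
Hypothesis rk0 : rk \bot = 0%R.
Hypothesis rk_le : forall x y, x <= y -> (rk x <= rk y)%R.
Hypothesis rk_covers : forall x y, covers x y -> (rk y = rk x + 1)%R.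
Hypothesis rk_modular : forall x y, (rk x + rk y = rk (x `&` y) + rk (x `|` y))%R.

Lemma rk_lt x y : x < y -> (rk x + 1 <= rk y)%R.
Proof.
move=> xy; have ok : (x < y) && (y <= y) by rewrite xy lexx.
case: (@arg_minnP L y (fun z => (x < z) && (z <= y))
  (fun z => #|[set w | w <= z]|)) => //.
move=> z /andP[xz zy] zmin; rewrite -(rk_covers (y := z)) ?rk_le //.
rewrite /covers xz; apply/forallP => w; apply/negP => /andP[xw wz].
have := zmin w; rewrite xw (le_trans (ltW wz) zy) => /(_ isT).
rewrite leqNgt => /negP[]; apply/proper_card/properP; split.
  by apply/subsetP => v; rewrite !inE => /le_trans; apply; apply: ltW.
by exists z; rewrite !inE ?lexx // lt_geF.
Qed.

Lemma rk_eq0 x : (rk x <= 0)%R -> x = \bot.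
Proof.
move=> h; apply/eqP; apply: contraLR h; rewrite -lt0x => /rk_lt.
by rewrite rk0 add0r => h; rewrite -ltNge (lt_le_trans _ h).
Qed.

Lemma rk_join_atom x b : b \in atoms L -> ~~ (b <= x) -> (rk (x `|` b) = rk x + 1)%R.
Proof.
rewrite inE => cb bx; have rb := rk_covers cb.
suff e : x `&` b = \bot.
  by move: (rk_modular x b); rewrite e rb rk0 add0r => ->; rewrite add0r.
apply: rk_eq0; have : x `&` b < b.
  by rewrite lt_neqAle leIr andbT; apply: contraNneq bx => <-; apply: leIl.
by move=> /rk_lt; rewrite rb rk0 add0r -lerBrDr subrr.
Qed.

(** Take an atom b not below a. If a and b did not join to the top, an atom c outside their join
    would give, by ranks, a as the meet of its joins with b and with c, contradicting
    irreducibility. *)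
Lemma rk_mi a : a \in mi L -> (rk a + 1 = rk \top)%R.
Proof.
rewrite inE => /andP[a1 /forallP irr].
have [|b bat /andP[_ ba]] := @atom_separate a \top; first by rewrite le1x.
suff <- : a `|` b = \top by rewrite rk_join_atom.
apply/eqP; rewrite -le1x; apply: contraT => /atom_separate[c cat /andP[_ cab]].
have ca : ~~ (c <= a) by apply: contraNN cab => /le_trans; apply; apply: leUl.
have rab := rk_join_atom bat ba; have rac := rk_join_atom cat ca.
have rabc := rk_join_atom cat cab.
have := rk_modular (a `|` b) (a `|` c); rewrite joinACA joinxx joinA rabc rab rac => e.
set w := (a `|` b) `&` (a `|` c) in e.
have aw : a <= w by rewrite lexI !leUl.
have ew : a = w.
  apply/eqP; rewrite eq_le aw /=; apply: contraT => wa.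
  have /rk_lt : a < w by rewrite lt_neqAle aw andbT; apply: contraNneq wa => <-.
  by move: e; clear; lia.
have := forallP (irr (a `|` b)) (a `|` c); rewrite -/w -ew eqxx /=.
case/orP => /eqP ea; first by rewrite {1}ea leUr in ba.
by rewrite {1}ea leUr in ca.
Qed.

Lemma rk_meet_mi x a : a \in mi L -> ~~ (x <= a) -> (rk (a `&` x) + 1 = rk x)%R.
Proof.
move=> /rk_mi ra xa; rewrite meetC; have := rk_modular x a.
set j := x `|` a; set m := x `&` a => e.
have /rk_lt h1 : a < j.
  by rewrite lt_neqAle leUr andbT; apply: contraNneq xa => ->; apply: leUl.
have h2 : (rk j <= rk \top)%R by apply/rk_le/lex1.
move: e h1 h2 ra; clear; lia.
Qed.

Local Notation c := (@enum_val L (mem (mi L))).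
Local Notation Idx := 'I_(#|mi L|).
Implicit Types B Y Z : {set Idx}.

Definition meet_mi Z : L := \meet_(i in Z) c i.

Lemma meet_miU1 j Z : meet_mi (j |: Z) = c j `&` meet_mi Z.
Proof.
have [jZ|jZ] := boolP (j \in Z); last by rewrite /meet_mi big_setU1.
by rewrite (setUidPr _) ?sub1set //; apply/esym/meet_idPr; apply: meets_inf.
Qed.

(** The bases of the matroid on the coatoms in which Y has rank rk(top) - rk(meet of Y). *)
Definition mi_bases : {set {set Idx}} :=
  [set B : {set Idx} | (#|B|%:R == rk \top)%R && (meet_mi B == \bot)].

(** Up to the constant rk(top) this compares nullities: adding a coatom lowers the rank of the meet
    by at most 1. *)
Lemma rk_meet_mi_le Y Z : Y \subset Z ->
  (rk (meet_mi Y) + #|Y|%:R <= rk (meet_mi Z) + #|Z|%:R)%R.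
Proof.
elim: {Z}#|Z :\: Y| {-2}Z (erefl #|Z :\: Y|) => [|N IH] Z cZ sYZ.
  suff -> : Y = Z by [].
  by apply/eqP; rewrite eqEsubset sYZ -setD_eq0 -cards_eq0 cZ.
have /card_gt0P[j] : (0 < #|Z :\: Y|)%N by rewrite cZ.
rewrite inE => /andP[jY jZ]; have eZ : Z = j |: Z :\ j by rewrite setD1K.
apply: le_trans (IH (Z :\ j) _ _) _.
- apply: succn_inj; rewrite -cZ [RHS](cardsD1 j) inE jY jZ.
  by rewrite setDDl setUC -setDDl.
- by rewrite subsetD1 sYZ.
rewrite {3 4}eZ meet_miU1 cardsU1 !inE eqxx /= add1n -natr1.
have [le_j|nle_j] := boolP (meet_mi (Z :\ j) <= c j).
  by rewrite (meet_idPr le_j) lerD2l lerDl.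
by rewrite -[in X in (X + _ <= _)%R](rk_meet_mi (enum_valP j) nle_j) addrAC addrA.
Qed.

(** Independence, as vanishing nullity: the nullity is monotone, zero on the empty set and zero on
    B. *)
Lemma mi_bases_indep B Y : B \in mi_bases -> Y \subset B ->
  (rk (meet_mi Y) + #|Y|%:R = rk \top)%R.
Proof.
rewrite inE => /andP[/eqP cB /eqP B0] sY; apply/eqP; rewrite eq_le.
have := rk_meet_mi_le sY; rewrite B0 rk0 cB add0r => -> /=.
by have := rk_meet_mi_le (sub0set Y); rewrite /meet_mi big_set0 cards0 addr0.
Qed.

(** Greedy extension: while the meet of Y is nonzero, some coatom in Z is not above it, and adding
    that coatom keeps Y independent. *)
Lemma mi_bases_extend Y Z : Y \subset Z -> meet_mi Z = \bot ->
  (rk (meet_mi Y) + #|Y|%:R = rk \top)%R ->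
  exists2 B, B \in mi_bases & (Y \subset B) && (B \subset Z).
Proof.
elim: {Y}#|Z :\: Y| {-2}Y (leqnn #|Z :\: Y|) => [|N IH] Y cY sYZ Z0 rY.
  have eYZ : Y = Z.
    by apply/eqP; rewrite eqEsubset sYZ -setD_eq0 -cards_eq0 -leqn0.
  exists Y; last by rewrite subxx.
  by rewrite inE eYZ Z0 eqxx andbT -rY eYZ Z0 rk0 add0r.
have [Y0|Y0] := eqVneq (meet_mi Y) \bot.
  by exists Y; rewrite ?subxx // inE Y0 eqxx andbT -rY Y0 rk0 add0r.
have [j jZ nj] : exists2 j, j \in Z & ~~ (meet_mi Y <= c j).
  apply: contrapT => h; case/negP: Y0; rewrite -lex0 -Z0; apply/meetsP => j jZ.
  by apply: contraT => nj; case: h; exists j.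
have jY : j \notin Y by apply: contraNN nj => jY; apply: meets_inf.
have [||//||B Bb /andP[sB BZ]] := IH (j |: Y).
- rewrite -ltnS; apply: leq_trans cY; apply: proper_card; apply/properP; split.
    by apply/subsetP => i; rewrite !inE negb_or -andbA => /and3P[_ -> ->].
  by exists j; rewrite !inE ?jY ?jZ ?eqxx.
- by rewrite subUset sub1set jZ.
- by rewrite meet_miU1 cardsU1 jY -rY -(rk_meet_mi (enum_valP j) nj) /=
    add1n -natr1 addrAC addrA.
exists B => //; rewrite BZ andbT; apply: subset_trans sB; exact: subsetUr.
Qed.

(** Extend the independent set of j and the common part of B1 and B2 to a basis inside j and B2. By
    cardinality it omits exactly one b of B2, which is not in B1. *)
Lemma mi_bases_exchange : exchange mi_bases.
Proof.
move=> B1 B2 j B1b B2b jB1 jB2.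
have cB B : B \in mi_bases -> (#|B|%:R = rk \top)%R by rewrite inE => /andP[/eqP].
have [|||B Bb /andP[sYB sBZ]] := @mi_bases_extend (j |: B1 :&: B2) (j |: B2).
- by rewrite setUS // subsetIr.
- apply/eqP; rewrite meet_miU1; move: B2b; rewrite inE => /andP[_ /eqP->].
  by rewrite meetx0.
- by apply: mi_bases_indep B1b _; rewrite subUset sub1set jB1 subsetIl.
have eqc : #|B| = #|B2|.
  by apply/eqP; rewrite -(eqr_nat int) (cB B) // (cB B2).
have jB : j \in B by apply: (subsetP sYB); rewrite setU11.
have [b bB2 bB] : exists2 b, b \in B2 & b \notin B.
  apply/subsetPn; apply/negP => sB2; suff : B2 \proper B.
    by move/proper_card; rewrite eqc ltnn.
  by apply/properP; split=> //; exists j.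
exists b; split=> //.
  apply: contraNN bB => bB1; apply: (subsetP sYB).
  by rewrite !inE bB1 bB2 orbT.
suff <- : B = j |: B2 :\ b by [].
apply/eqP; rewrite eqEcard cardsU1 !inE (negPf jB2) andbF /= add1n.
have := cardsD1 b B2; rewrite bB2 add1n => <-; rewrite eqc leqnn andbT.
apply/subsetP => i iB; have := subsetP sBZ i iB; rewrite !inE => /orP[->//|->].
by rewrite andbT orbC; apply/orP; left; apply: contraNneq bB => <-.
Qed.

End RankedLattice.

(** * The Phan ideal *)

Section PhanMonomials.
Variables (k : fieldType) (disp : Order.disp_t) (L : finTBLatticeType disp).
Hypothesis L_atomic : atomic L.
Local Notation n := (#|mi L|).
Local Notation c := (@enum_val L (mem (mi L))).
Local Notation S := {mpoly k[n]}.
Implicit Types (x y b : L) (m : 'X_{1..n}).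

(** Defined on all of L, not only on atoms, so as to embed L as the LCM lattice. *)
Definition phan_mnm x : 'X_{1..n} := [multinom nat_of_bool (~~ (x <= c i)%O) | i < n].

Lemma phan_genE b : phan_gen k b = 'X_[phan_mnm b].
Proof.
rewrite mpolyXE_id /phan_gen big_mkcond; apply: eq_bigr => i _.
by rewrite mnmE; case: ifP.
Qed.

Lemma phan_idealP : is_ideal (fun p : S => p \in phan_ideal k L : Prop).
Proof.
split=> [|p q|a p]; [exact: idealr0|exact: rpredD|exact: idealMr].
Qed.

Lemma phan_mnm_in b m : b \in atoms L ->
  (phan_mnm b <= m)%MM -> 'X_[m] \in phan_ideal k L.
Proof.
move=> bat le_bm; rewrite -(submK le_bm) mpolyXD; apply: idealMr.
rewrite -phan_genE; apply/ideal_genP.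
have bi : (index b (enum (atoms L)) < size [seq phan_gen k b | b in atoms L])%N.
  by rewrite size_map index_mem mem_enum.
exists (fun i => (i == index b (enum (atoms L)))%:R).
rewrite (bigD1 (Ordinal bi)) //= eqxx mul1r big1 ?addr0 => [|i].
  by rewrite (nth_map b) ?nth_index ?index_mem ?mem_enum.
by rewrite -val_eqE /= => /negPf->; rewrite mul0r.
Qed.

Lemma phan_ideal_msupp (p : S) m : p \in phan_ideal k L -> m \in msupp p ->
  exists2 b, b \in atoms L & (phan_mnm b <= m)%MM.
Proof.
move=> /ideal_genP[q ->] /msupp_sum_le /flatten_mapP[i _].
rewrite (nth_map \bot%O) -?(size_map (phan_gen k)) // phan_genE.
move=> /msuppM_le/allpairsP[[m1 m2] /= [_ ]]; rewrite msuppX inE => /eqP-> ->.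
exists (nth \bot%O (enum (atoms L)) i); last exact: lem_addl.
by rewrite -mem_enum mem_nth // -(size_map (phan_gen k)).
Qed.

Lemma lem_phan_mnm x y : (phan_mnm x <= phan_mnm y)%MM = (x <= y)%O.
Proof.
apply/mnm_lepP/idP => [h|le_xy i]; last first.
  by rewrite !mnmE; case: (boolP (y <= _)%O) => [/(le_trans le_xy)->|_] //; case: (~~ _).
apply: contraT => /mi_separate[a ami /andP[ya xa]].
have := h (enum_rank_in ami a); rewrite !mnmE !enum_rankK_in //.
by rewrite ya xa.
Qed.

Lemma phan_mnm_inj : injective phan_mnm.
Proof.
by move=> x y e; apply/eqP; rewrite eq_le -!lem_phan_mnm e !lepm_refl.
Qed.

Lemma min_gen_phan m :
  min_gen (phan_ideal k L) m <-> exists2 b, b \in atoms L & m = phan_mnm b.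
Proof.
split=> [[mI mmin]|[b bat ->]].
  have [|b bat le_bm] := phan_ideal_msupp mI (m := m); first by rewrite msuppX inE.
  exists b => //; apply/esym/mmin => //; exact: phan_mnm_in (lepm_refl _).
split=> [|m' m'I le_m']; first exact: phan_mnm_in (lepm_refl _).
have [|b' b'at le_b'] := phan_ideal_msupp m'I (m := m'); first by rewrite msuppX inE.
have := lepm_trans le_b' le_m'; rewrite lem_phan_mnm => le_b'b.
suff eb : b' = b.
  by apply/mnmP => i; apply/eqP; rewrite eqn_leq (mnm_lepP le_m') -eb (mnm_lepP le_b').
move: bat b'at; rewrite !inE => /andP[b0 /forallP/(_ b')] h /andP[b'0 _].
by apply: contraNeq h => nb; rewrite b'0 lt_neqAle nb le_b'b.
Qed.

Lemma phan_mnm0 : phan_mnm \bot%O = 0%MM.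
Proof. by apply/mnmP => i; rewrite mnmE le0x mnm0E. Qed.

Lemma phan_mnm_join x y : phan_mnm (x `|` y)%O = mlcm (phan_mnm x) (phan_mnm y).
Proof.
by apply/mnmP => i; rewrite !mnmE leUx negb_and; case: (_ <= _)%O; case: (_ <= _)%O.
Qed.

Lemma lcm_lattice_phan m :
  lcm_lattice (phan_ideal k L) m <-> exists x, m = phan_mnm x.
Proof.
split=> [[s hs ->]|[x ->]].
  elim: s hs => [|g s IH] hs; first by exists \bot%O; rewrite big_nil phan_mnm0.
  have [|x ex] := IH; first by move=> g' g's; apply: hs; rewrite inE g's orbT.
  have /min_gen_phan[b _ eb] := hs g (mem_head _ _).
  by exists (b `|` x)%O; rewrite big_cons ex eb phan_mnm_join.
have [A /subsetP sA ->] := L_atomic x.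
exists [seq phan_mnm b | b <- index_enum L & b \in A].
  move=> g /mapP[b]; rewrite mem_filter => /andP[/sA bat _] ->.
  by apply/min_gen_phan; exists b.
by rewrite big_map big_filter (big_morph _ phan_mnm_join phan_mnm0).
Qed.

Lemma phan_modular_rank : lcm_lattice_modular (phan_ideal k L) ->
  exists rk : L -> int, [/\ rk \bot%O = 0, forall x y, (x <= y)%O -> rk x <= rk y,
    forall x y, covers x y -> rk y = rk x + 1 &
    forall x y, rk x + rk y = rk (x `&` y)%O + rk (x `|` y)%O].
Proof.
have P x : lcm_lattice (phan_ideal k L) (phan_mnm x) by apply/lcm_lattice_phan; exists x.
case=> rk [rk_le rk0 rk_cov] rk_mod; exists (rk \o phan_mnm) => /=; split.
- apply: rk0; split=> // y /lcm_lattice_phan[x ->].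
  by rewrite /divides lem_phan_mnm le0x.
- by move=> x y le_xy; apply: rk_le => //; rewrite /divides lem_phan_mnm.
- move=> x y /andP[lt_xy /forallP hxy]; apply: rk_cov; split=> //.
  + by rewrite /divides lem_phan_mnm ltW.
  + by move=> /phan_mnm_inj e; move: lt_xy; rewrite e ltxx.
  + move=> _ /lcm_lattice_phan[z ->]; rewrite /divides !lem_phan_mnm => xz zy.
    have := hxy z; rewrite !lt_neqAle xz zy !andbT negb_and !negbK.
    by case/orP => /eqP->; [left|right].
- move=> x y; apply: rk_mod => //.
    split=> //; rewrite /divides ?lem_phan_mnm ?leIl ?leIr //.
    by move=> _ /lcm_lattice_phan[z ->]; rewrite !lem_phan_mnm lexI => -> ->.
  split=> //; rewrite /divides ?lem_phan_mnm ?leUl ?leUr //.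
  by move=> _ /lcm_lattice_phan[z ->]; rewrite !lem_phan_mnm leUx => -> ->.
Qed.

(** The generator of an atom b meets a basis B because b is not below the meet of B. Conversely, if
    m meets all bases, the coatoms with exponent 0 in m contain none, so their meet is nonzero; the
    generator of an atom below it divides m. *)
Lemma phan_ideal_cover (rk : L -> int) : rk \bot%O = 0 ->
  (forall x y, (x <= y)%O -> rk x <= rk y) ->
  (forall x y, covers x y -> rk y = rk x + 1) ->
  (forall x y, rk x + rk y = rk (x `&` y)%O + rk (x `|` y)%O) ->
  forall p : S, p \in phan_ideal k L <-> cover_ideal (mi_bases rk) p.
Proof.
move=> rk0 rk_le rk_cov rk_mod p; split=> [pI m mp B|].
  have [b] := phan_ideal_msupp pI mp; rewrite inE => /andP[b0 _] le_bm.
  rewrite inE => /andP[_ /eqP B0].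
  have [i iB nbi] : exists2 i, i \in B & ~~ (b <= c i)%O.
    apply: contrapT => h; move: b0; rewrite lt0x => /negP[]; rewrite -lex0 -B0.
    by apply/meetsP => i iB; apply: contraT => nbi; case: h; exists i.
  apply/existsP; exists i; rewrite iB -lt0n; apply: leq_trans (mnm_lepP le_bm i).
  by rewrite mnmE nbi.
apply: cover_ideal_sub phan_idealP _ _ => m mB.
pose Z := [set i | m i == 0%N].
have Z0 : meet_mi Z != \bot%O.
  apply/eqP => Z0; have [|B Bb /andP[_ BZ]] :=
    mi_bases_extend L_atomic rk0 rk_le rk_cov rk_mod (sub0set Z) Z0.
    by rewrite /meet_mi big_set0 cards0 addr0.
  have /existsP[i /andP[/(subsetP BZ)]] := mB B Bb.
  by rewrite inE => ->.
have [|b bat /andP[bZ _]] := atom_separate L_atomic (x := \bot%O) (y := meet_mi Z).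
  by rewrite lex0.
apply: phan_mnm_in bat _; apply/mnm_lepP => i; rewrite mnmE.
case: (boolP (b <= _)%O) => //= nbi; rewrite lt0n; apply: contraNN nbi => mi0.
by apply: le_trans bZ _; apply: meets_inf; rewrite inE.
Qed.

End PhanMonomials.

(** * Cohen-Macaulayness from the exchange property *)

Section CoverIdealCohenMacaulay.
Variables (k : fieldType) (n : nat).
Local Notation S := {mpoly k[n]}.

(** Otherwise the product of all variables outside Q would meet every member of F and so lie in
    Q. *)
Lemma prime_over_cover_ideal (F : {set {set 'I_n}}) (Q : S -> Prop) :
  is_prime Q -> (forall p, cover_ideal F p -> Q p) ->
  exists2 B, B \in F & forall j, j \in B -> Q 'X_j.
Proof.
move=> [iQ Q1 QM] FQ; apply: contrapT => nB.
pose u : S := \prod_(j < n | `[< ~ Q 'X_j >]) 'X_j.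
have nQu : ~ Q u.
  by apply: (big_ind (fun x => ~ Q x)) => // [x y nx ny /QM[]//|j /asboolP].
apply: nQu; apply: FQ; rewrite /u mprodXE; apply/cover_idealX => B BF.
have [j jB nj] : exists2 j, j \in B & ~ Q 'X_j.
  apply: contrapT => h; apply: nB; exists B => // j jB.
  by apply: contrapT => nj; apply: h; exists j.
apply/existsP; exists j; rewrite jB mnm_sumE (bigD1 j) /=; last exact/asboolP.
by rewrite mnm1E eqxx.
Qed.

Variable I : idealr S.
Local Notation R := {ideal_quot I}.

Theorem cover_ideal_cohen_macaulay (F : {set {set 'I_n}}) r :
  (forall p, p \in I <-> cover_ideal F p) -> (forall B, B \in F -> #|B| = r) ->
  exchange F -> cohen_macaulay R.
Proof.
move=> IF cF exF P maxP.
have pi0 x : (x \in I) = (\pi_R x == 0).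
  by rewrite -[0](rmorph0 \pi_R) -Quotient.idealrBE subr0.
pose P' (x : S) : Prop := \pi_R x \in P.
have pP' : is_prime P' :=
  prime_preimage (\pi_R : {rmorphism S -> R}) (prime_idealr_is_prime P).
have [iP' P'1 P'M] := pP'.
have FP' p : cover_ideal F p -> P' p.
  by move=> /IF; rewrite pi0 /P' => /eqP->; apply: idealr0.
have [B0 B0F B0P] := prime_over_cover_ideal pP' FP'.
have [d dn] : exists d, (r + d)%N = n.
  exists (n - r)%N; rewrite subnKC // -(cF _ B0F).
  by apply: leq_trans (max_card _) _; rewrite card_ord.
(* The bases that survive localization at P. *)
pose FP := [set B in F | [forall j in B, \pi_R 'X_j \in P]].
have /choice[f hf] j : exists f : {poly k},
    [/\ f != 0, P' (univ j f) & P' 'X_j -> f = 'X].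
  have [Xj|nXj] := boolP (\pi_R 'X_j \in P).
    by exists 'X; split; rewrite ?polyX_eq0 ?univX.
  by have [f f0 fP] := univ_in_maximal j maxP; exists f; split=> // h; case/negP: nXj.
pose y j := univ j (f j).
have wr : weakly_regular (cover_ideal FP) (elem_syms y d).
  apply: weakly_regular_cover_ideal.
  - by move=> C j x jC; apply: univ_regular => //; case: (hf j).
  - apply/set0Pn; exists B0; rewrite inE B0F; apply/forall_inP; exact: B0P.
  - by move=> B; rewrite inE => /andP[/cF-> _].
  - move=> B j; rewrite inE => /andP[_ /forall_inP h] /h Xj.
    by rewrite /y; have [_ _ ->//] := hf j; apply: univX.
  - move=> B1 B2 j; rewrite !inE.
    move=> /andP[B1F /forall_inP h1] /andP[B2F /forall_inP h2] jB1 jB2.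
    have [b [bB2 bB1 B'F]] := exF _ _ _ B1F B2F jB1 jB2; exists b; split=> //.
    rewrite inE B'F; apply/forall_inP => i; rewrite !inE => /predU1P[->|/andP[_ /h2//]].
    exact: h1.
(* A basis outside [FP] contains some j with x_j outside P, so u carries [cover_ideal FP] into I,
   while u becomes a unit. *)
pose u : S := \prod_(j < n | \pi_R 'X_j \notin P) 'X_j.
have nPu : ~ P' u.
  by apply: (big_ind (fun x => ~ P' x)) => // [x z nx nz /P'M[]//|j /negP].
have uI p : cover_ideal FP p -> u * p \in I.
  move=> hp; apply/IF => m /msuppM_le/allpairsP[[m1 m2] /= []].
  rewrite /u mprodXE msuppX inE => /eqP-> pm2 -> B BF.
  have [BP|] := boolP [forall j in B, \pi_R 'X_j \in P].
    by rewrite addmC; apply/meetsDl/hp => //; rewrite inE BF.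
  rewrite negb_forall_in => /exists_inP[j jB jP]; apply: meetsDl.
  by apply/existsP; exists j; rewrite jB mnm_sumE (bigD1 j) //= mnm1E eqxx.
(* Only positive degrees occur, so each term contains some y_j in P. *)
have gP a : a \in elem_syms y d -> \pi_R a \in P.
  elim: (d) => //= t IH; rewrite inE => /predU1P[->|/IH//].
  rewrite -[is_true _]/(P' (elem_sym y t.+1)); apply: ideal_sum => // A /eqP cA.
  have /card_gt0P[j jA] : (0 < #|A|)%N by rewrite cA.
  by rewrite (bigD1 j) //=; apply: ideal_mulr => //; have [] := hf j.
have [||reg nonu] := quot_loc_regular_seq (P := P) (cover_idealP k FP) _ _ uI wr gP.
- by move=> x /IF h m /h hm B; rewrite inE => /andP[/hm].
- exact/negP.
apply: (local_cohen_macaulay_of reg nonu) => m Q chQ.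
have -> : size (map (to_loc P \o \pi_R) (elem_syms y d)) = d.
  by rewrite size_map; elim: (d) => //= t ->.
pose iota : {rmorphism S -> localization P} := to_loc P \o \pi_R.
pose Q' i (x : S) : Prop := iota x \in Q i.
have pQ' i : is_prime (Q' i) := prime_preimage iota (prime_idealr_is_prime (Q i)).
have FQ p : cover_ideal F p -> Q' 0%N p.
  by move=> /IF; rewrite pi0 /Q' /iota /= => /eqP->; rewrite rmorph0 idealr0.
have [B BF BQ] := prime_over_cover_ideal (pQ' 0%N) FQ.
apply: (@chain_length k n Q' B) => // [|i lt_im]; first by rewrite (cF _ BF).
have [sub nsub] := chQ i lt_im; split=> [x /sub//|].
(* Denominators are units, so strictness of the chain is witnessed by numerators. *)
apply: contrapT => h; apply: nsub => x xQ; apply: contrapT => xnQ.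
have [t [p [tP e]]] := to_loc_frac x; apply: h; exists (repr p).
rewrite /Q' /iota /= reprK -e; split; first exact: idealMr.
rewrite prime_idealrM => /orP[tQ|//]; have [v ev] := to_loc_unit tP.
by move: (idealMr v tQ); rewrite ev idealr1.
Qed.

End CoverIdealCohenMacaulay.

Theorem theorem4p1 (k : fieldType) (disp : Order.disp_t)
    (L : finTBLatticeType disp)
    (L_atomic : atomic L)
    (lcm_modular : lcm_lattice_modular (phan_ideal k L)) :
  cohen_macaulay {ideal_quot (phan_ideal k L)}.
Proof.
have [rk [rk0 rk_le rk_cov rk_mod]] := phan_modular_rank L_atomic lcm_modular.
(* Ranks are integers; the absolute value turns the rank of L into the common size of the bases. *)
apply: (@cover_ideal_cohen_macaulay k _ _ (mi_bases rk) `|rk \top%O|%N).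
- exact: phan_ideal_cover.
- move=> B; rewrite inE => /andP[/eqP cB _].
  by rewrite -cB natz absz_nat.
- exact: mi_bases_exchange.
Qed.
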